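(* Let $\mathcal K$ be a relational Fraïssé class which is Ramsey. If $G_\mathcal K$ is amenable, then $G_\mathcal K$ is uniquely ergodic, and the unique $G_\mathcal K$-invariant Borel probability measure on $M(G_\mathcal K)$ is concentrated on (i.e. gives measure $1$ to) an orbit which is dense $G_\delta$ in $M(G_\mathcal K)$; moreover this dense $G_\delta$ orbit is unique.
   Context: Structures are over a countable relational language $L$. A class $\mathcal K$ of finite $L$-structures is a Fraïssé class if it is hereditary, has joint embedding, has amalgamation, and contains arbitrarily large finite structures; $\mathrm{Flim}(\mathcal K)$ is its Fraïssé limit (the unique countable ultrahomogeneous structure with age $\mathcal K$), and $G_\mathcal K=\mathrm{Aut}(\mathrm{Flim}(\mathcal K))$ with the pointwise convergence topology. $\binom{B}{A}$ is the set of substructures of $B$ isomorphic to $A$; $C\to(B)^A_{k,d}$ means every colouring $\chi:\binom{C}{A}\to\{0,\dots,k-1\}$ admits $B'\in\binom{C}{B}$ with $|\chi(\binom{B'}{A})|\le d$; $\mathcal K$ is Ramsey if for all $A,B\in\mathcal K$ and $k\ge2$ there is $C\in\mathcal K$ with $C\to(B)^A_{k,1}$. $M(G)$ denotes the universal minimal $G$-flow (a $G$-flow is a continuous action on a compact Hausdorff space). $G$ is amenable if there exists a $G$-invariant Borel probability measure on $M(G)$, and uniquely ergodic if there is exactly one. *)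

(* Defs.v *)
From HB Require Import structures.
From mathcomp Require Import all_boot all_order all_algebra.
From mathcomp Require Import all_classical all_reals all_analysis.
From Stdlib Require List.
Set Implicit Arguments. Unset Strict Implicit. Unset Printing Implicit Defensive.
Import Order.TTheory GRing.Theory Num.Theory.
Local Open Scope classical_set_scope.

Record language := Language { sym : countType ; arity : sym -> nat }.

Record structure (L : language) := Structure {
  carrier :> Type ;
  rel : forall s : sym L, ('I_(arity s) -> carrier) -> Prop }.

Arguments rel {L} _ s _.

Definition embedding (L : language) (A B : structure L) (f : A -> B) : Prop :=
  injective f /\ forall (s : sym L) (t : 'I_(arity s) -> A), rel A s t <-> rel B s (f \o t).

Definition isomorphism (L : language) (A B : structure L) (f : A -> B) : Prop :=
  embedding f /\ bijective f.

Definition isomorphic (L : language) (A B : structure L) : Prop :=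
  exists f : A -> B, isomorphism f.

Definition embeds (L : language) (A B : structure L) : Prop :=
  exists f : A -> B, embedding f.

Definition finite_structure (L : language) (A : structure L) : Prop :=
  exists n (f : 'I_n -> A), bijective f.

Definition induced (L : language) (C : structure L) (S : set C) : structure L :=
  @Structure L {x : C | S x} (fun s t => rel C s (fun i => sval (t i))).

Definition class_of_finite (L : language) (K : structure L -> Prop) : Prop :=
  (forall A, K A -> finite_structure A) /\
  (forall A B, K A -> isomorphic A B -> K B).

Definition hereditary (L : language) (K : structure L -> Prop) : Prop :=
  forall A B : structure L, K A -> embeds B A -> K B.

Definition joint_embedding (L : language) (K : structure L -> Prop) : Prop :=
  forall A B, K A -> K B -> exists C, K C /\ embeds A C /\ embeds B C.

Definition amalgamation (L : language) (K : structure L -> Prop) : Prop :=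
  forall (A B1 B2 : structure L) (f1 : A -> B1) (f2 : A -> B2),
    K A -> K B1 -> K B2 -> embedding f1 -> embedding f2 ->
    exists (C : structure L) (g1 : B1 -> C) (g2 : B2 -> C),
      [/\ K C, embedding g1, embedding g2 & forall a, g1 (f1 a) = g2 (f2 a)].

Definition arbitrarily_large (L : language) (K : structure L -> Prop) : Prop :=
  forall n : nat, exists A : structure L, K A /\ exists f : 'I_n -> A, injective f.

Definition fraisse_class (L : language) (K : structure L -> Prop) : Prop :=
  [/\ class_of_finite K, hereditary K, joint_embedding K, amalgamation K
    & arbitrarily_large K].

Definition copies (L : language) (C A : structure L) : set (set C) :=
  [set S | isomorphic A (induced S)].
Arguments copies {L} C A.

Definition arrows (L : language) (C B A : structure L) (k : nat) : Prop :=
  forall chi : set C -> 'I_k,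
    exists2 B' : set C, copies C B B' &
      exists c : 'I_k, forall S : set C, copies C A S -> S `<=` B' -> chi S = c.

Definition ramsey_class (L : language) (K : structure L -> Prop) : Prop :=
  forall (A B : structure L) (k : nat), K A -> K B -> 2 <= k ->
    exists C : structure L, K C /\ arrows C B A k.

Definition countable_structure (L : language) (F : structure L) : Prop :=
  exists f : F -> nat, injective f.

Definition age_is (L : language) (F : structure L) (K : structure L -> Prop) : Prop :=
  forall A : structure L, finite_structure A -> (K A <-> embeds A F).

Definition automorphism (L : language) (F : structure L) (g : F -> F) : Prop :=
  isomorphism (A := F) (B := F) g.

Definition ultrahomogeneous (L : language) (F : structure L) : Prop :=
  forall (S1 S2 : set F) (p : induced S1 -> induced S2),
    finite_structure (induced S1) -> isomorphism p ->
    exists g : F -> F, automorphism g /\ forall x : induced S1, g (sval x) = sval (p x).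

Definition fraisse_limit (L : language) (K : structure L -> Prop)
    (F : structure L) : Prop :=
  countable_structure F /\ age_is F K /\ ultrahomogeneous F.

(* G-flows for G = Aut(F), with the pointwise convergence topology       *)

Section Flows.
Variable (L : language) (F : structure L).

(* basic neighbourhoods of g in Aut(F): automorphisms agreeing with g on a finite set *)
Definition agree_on (S : seq F) (g h : F -> F) : Prop :=
  forall n : F, List.In n S -> h n = g n.

Definition flow (X : topologicalType) (act : (F -> F) -> X -> X) : Prop :=
  [/\ compact [set: X], hausdorff_space X,
      forall x, act id x = x,
      forall g h x, automorphism g -> automorphism h ->
                    act (g \o h) x = act g (act h x)
    & forall g x (U : set X), automorphism g -> nbhs (act g x) U ->
        exists (S : seq F) (V : set X), nbhs x V /\
          forall h y, automorphism h -> agree_on S g h -> V y -> U (act h y)].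

Definition invariant_set (X : topologicalType) (act : (F -> F) -> X -> X)
    (A : set X) : Prop :=
  forall g x, automorphism g -> A x -> A (act g x).

Definition minimal_flow (X : topologicalType) (act : (F -> F) -> X -> X) : Prop :=
  [/\ flow act, [set: X] !=set0
    & forall A : set X, closed A -> invariant_set act A -> A = set0 \/ A = setT].

Definition flow_morphism (X Y : topologicalType) (actX : (F -> F) -> X -> X)
    (actY : (F -> F) -> Y -> Y) (f : X -> Y) : Prop :=
  continuous f /\ forall g x, automorphism g -> f (actX g x) = actY g (f x).

Definition universal_minimal_flow (M : topologicalType)
    (act : (F -> F) -> M -> M) : Prop :=
  minimal_flow act /\
  forall (Y : topologicalType) (actY : (F -> F) -> Y -> Y), minimal_flow actY ->
    exists f : M -> Y, flow_morphism act actY f /\ (forall y : Y, exists x : M, f x = y).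

Definition g_orbit (X : topologicalType) (act : (F -> F) -> X -> X) (x : X) : set X :=
  [set y | exists2 g, automorphism g & y = act g x].

Definition G_delta (X : topologicalType) (A : set X) : Prop :=
  exists U : nat -> set X, (forall n, open (U n)) /\ A = \bigcap_n U n.

End Flows.

Definition borel (X : ptopologicalType) := g_sigma_algebraType (@open X).

Definition invariant_measure (L : language) (F : structure L) (R : realType)
    (X : ptopologicalType) (act : (F -> F) -> X -> X)
    (mu : probability (borel X) R) : Prop :=
  forall g (A : set (borel X)), automorphism g -> measurable A ->
    mu (act g @^-1` A) = mu A.

(* Main.v *)
Require Import Defs.
From HB Require Import structures.
From mathcomp Require Import all_boot all_order all_algebra.
From mathcomp Require Import all_classical all_reals all_analysis.
From mathcomp Require Import measurable_realfun.
Set Implicit Arguments. Unset Strict Implicit. Unset Printing Implicit Defensive.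
Import Order.TTheory GRing.Theory Num.Theory.
Local Open Scope classical_set_scope.

(** Write [G] for the automorphism group of the limit.  Colouring the copies of
    a finite set by the order type they inherit from an arbitrary linear order,
    the Ramsey property and compactness give a linear order on the limit in
    which isomorphic finite substructures are order-isomorphic.  Its orbit
    closure [X] is a minimal flow in which all orders occurring on a finite set
    are conjugate under the setwise stabiliser of that set.  A second Ramsey
    argument shows that the morphism from the universal minimal flow to [X] is
    injective, so the cylinders "[l] is increasing" are a clopen base.  An
    invariant measure must be uniform on the cylinders over a given finite set,
    hence it is unique.

    The generic orders, those realising every admissible one-point extension of
    a finite increasing list, form a G_delta set and, by back and forth, a
    single orbit.  The point is that they have full measure.  If two positions
    of [b] over a finite list are possible, below and above a segment [s], they
    are exchanged by an automorphism that rotates [b :: s].  The orbit of [b]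
    over the list is then infinite, since otherwise a proper colouring of a
    graph of bounded degree would contradict the Ramsey property.  As both
    positions have positive measure, arbitrarily many points of the orbit are
    simultaneously below [s] in one order and above [s] in another one.
    Comparing the two orders, disjoint blocks of these points can be moved onto
    [s] in such a way that the events "no point of the orbit of [b] is below
    [s]" pull back to pairwise disjoint events of equal measure, so that this
    measure vanishes. *)

(** * Permutation groups *)

Record permgroup (T : Type) := PermGroup {
  permgroup_mem :> (T -> T) -> Prop ;
  permgroup1 : permgroup_mem id ;
  permgroupM : forall g h, permgroup_mem g -> permgroup_mem h ->
    permgroup_mem (g \o h) ;
  permgroup_can : forall g, permgroup_mem g ->
    exists2 h, permgroup_mem h & cancel g h /\ cancel h g }.

Definition ginv (T : choiceType) (g : T -> T) (y : T) : T :=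
  xget y [set x | g x = y].

Lemma ginv_eq (T : choiceType) (g h : T -> T) : cancel g h -> cancel h g ->
  ginv g = h.
Proof.
move=> gh hg; apply/funext => y; apply: (can_inj gh); rewrite hg.
by rewrite [LHS](xgetPex y (P := [set x | g x = y]))//; exists (h y).
Qed.

Section PermGroup.
Variables (T : choiceType) (G : permgroup T).
Implicit Types g h : T -> T.

Lemma permgroupV g : G g -> G (ginv g).
Proof. by move=> /permgroup_can[h Gh [gh hg]]; rewrite (ginv_eq gh hg). Qed.

Lemma ginvK g : G g -> cancel g (ginv g).
Proof. by move=> /permgroup_can[h Gh [gh hg]]; rewrite (ginv_eq gh hg). Qed.

Lemma ginvKV g : G g -> cancel (ginv g) g.
Proof. by move=> /permgroup_can[h Gh [gh hg]]; rewrite (ginv_eq gh hg). Qed.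

Lemma permgroup_inj g : G g -> injective g.
Proof. by move=> /ginvK /can_inj. Qed.

Lemma ginvV g : G g -> ginv (ginv g) = g.
Proof. by move=> Gg; apply: ginv_eq; [exact: ginvKV|exact: ginvK]. Qed.

Lemma ginvM g h : G g -> G h -> ginv (g \o h) = ginv h \o ginv g.
Proof.
by move=> Gg Gh; apply: ginv_eq; apply: can_comp; first
  [exact: ginvK|exact: ginvKV].
Qed.

Lemma ginv1 : ginv id = id :> (T -> T).
Proof. exact: ginv_eq. Qed.

Lemma map_ginvK g : G g -> cancel (map g) (map (ginv g)).
Proof. by move=> /ginvK/mapK. Qed.

Lemma map_ginvKV g : G g -> cancel (map (ginv g)) (map g).
Proof. by move=> /ginvKV/mapK. Qed.

End PermGroup.

Section Conjugate.
Variable T : choiceType.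
Implicit Types (G : permgroup T) (g : T -> T) (s x y z : seq T).

Definition conjugate G x y := exists2 g, G g & map g x = y.

Lemma conjugate_refl G x : conjugate G x x.
Proof. by exists id; [exact: permgroup1|rewrite map_id]. Qed.

Lemma conjugate_sym G x y : conjugate G x y -> conjugate G y x.
Proof.
by move=> [g Gg <-]; exists (ginv g);
  [exact: permgroupV|rewrite (map_ginvK Gg)].
Qed.

Lemma conjugate_trans G y x z : conjugate G x y -> conjugate G y z ->
  conjugate G x z.
Proof.
by move=> [g Gg <-] [h Gh <-]; exists (h \o g);
  [exact: permgroupM|rewrite map_comp].
Qed.

Lemma conjugate_rot G n x y : conjugate G x y ->
  conjugate G (rot n x) (rot n y).
Proof. by move=> [g Gg <-]; exists g => //; rewrite map_rot. Qed.

Lemma conjugate_rev G x y : conjugate G x y -> conjugate G (rev x) (rev y).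
Proof. by move=> [g Gg <-]; exists g; rewrite ?map_rev. Qed.

Lemma conjugate_catl G x1 x2 y1 y2 : size x1 = size y1 ->
  conjugate G (x1 ++ x2) (y1 ++ y2) -> conjugate G x1 y1.
Proof.
move=> xy [g Gg] /eqP; rewrite map_cat eqseq_cat ?size_map//.
by move=> /andP[/eqP gx _]; exists g.
Qed.

Definition fixes G s g := G g /\ {in s, g =1 id}.

Fact fixes1 G s : fixes G s id.
Proof. by split=> //; exact: permgroup1. Qed.

Fact fixesM G s g h : fixes G s g -> fixes G s h -> fixes G s (g \o h).
Proof.
move=> [Gg gs] [Gh hs]; split; first exact: permgroupM.
by move=> a sa /=; rewrite hs ?gs.
Qed.

Fact fixes_can G s g : fixes G s g ->
  exists2 h, fixes G s h & cancel g h /\ cancel h g.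
Proof.
move=> [Gg gs]; exists (ginv g); last first.
  by split; [exact: ginvK Gg|exact: ginvKV Gg].
split=> [|a sa]; first exact: permgroupV.
by rewrite -{1}(gs a sa) (ginvK Gg).
Qed.

Definition fixator G s : permgroup T :=
  PermGroup (fixes1 G s) (@fixesM G s) (@fixes_can G s).

Lemma map_fixator G s g x : fixator G s g -> {subset x <= s} -> map g x = x.
Proof.
by move=> [_ gs] xs; rewrite -[RHS]map_id; apply/eq_in_map => a /xs/gs.
Qed.

Lemma map_fixator_cat G s1 s2 g x : fixator G (s1 ++ s2) g ->
  map g (s1 ++ x ++ s2) = s1 ++ map g x ++ s2.
Proof.
move=> fg; rewrite !map_cat.
rewrite (map_fixator fg (x := s1)) ?(map_fixator fg (x := s2))//;
  by move=> a; rewrite mem_cat => ->; rewrite ?orbT.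
Qed.

Lemma conjugate_fixatorP G s1 s2 x y : size x = size y ->
  conjugate (fixator G (s1 ++ s2)) x y <->
  conjugate G (s1 ++ x ++ s2) (s1 ++ y ++ s2).
Proof.
move=> xy; split=> -[g].
  by move=> fg <-; exists g; [case: fg|rewrite (map_fixator_cat _ fg)].
move=> Gg /eqP; rewrite !map_cat eqseq_cat ?size_map// eqseq_cat ?size_map//.
move=> /and3P[/eqP g1 /eqP gx /eqP g2]; exists g => //; split=> // a.
have fixed s : map g s = s -> a \in s -> g a = a.
  by rewrite -[RHS]map_id => /eq_in_map; apply.
by rewrite mem_cat => /orP[]; exact: fixed.
Qed.

End Conjugate.

(** * Flows *)

Section Flow.
Variables (T : choiceType) (G : permgroup T).
Implicit Types (g h : T -> T).

Definition gflow (X : topologicalType) (act : (T -> T) -> X -> X) : Prop :=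
  [/\ compact [set: X], hausdorff_space X, forall x, act id x = x,
      forall g h x, G g -> G h -> act (g \o h) x = act g (act h x)
    & forall g x (U : set X), G g -> nbhs (act g x) U ->
        exists (s : seq T) (V : set X), nbhs x V /\
          forall h y, G h -> {in s, h =1 g} -> V y -> U (act h y)].

Definition ginvariant_set (X : Type) (act : (T -> T) -> X -> X) (A : set X) :=
  forall g x, G g -> A x -> A (act g x).

Definition gminimal (X : topologicalType) (act : (T -> T) -> X -> X) : Prop :=
  [/\ gflow act, [set: X] !=set0 & forall A : set X, closed A ->
      ginvariant_set act A -> A = set0 \/ A = setT].

Definition gorbit (X : Type) (act : (T -> T) -> X -> X) (x : X) : set X :=
  [set y | exists2 g, G g & y = act g x].

Section FlowTheory.
Variables (X : topologicalType) (act : (T -> T) -> X -> X).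
Hypothesis Xflow : gflow act.

Lemma gflow_compact : compact [set: X]. Proof. by case: Xflow. Qed.

Lemma gflow_hausdorff : hausdorff_space X. Proof. by case: Xflow. Qed.

Lemma gflow_act1 x : act id x = x. Proof. by case: Xflow. Qed.

Lemma gflow_actM g h x : G g -> G h -> act (g \o h) x = act g (act h x).
Proof. by case: Xflow => _ _ _ actM _; exact: actM. Qed.

Lemma gflow_actK g : G g -> cancel (act g) (act (ginv g)).
Proof.
move=> Gg x; rewrite -gflow_actM//; last exact: permgroupV.
suff -> : ginv g \o g = id by exact: gflow_act1.
by apply/funext => a /=; rewrite (ginvK Gg).
Qed.

Lemma gflow_continuous g : G g -> continuous (act g).
Proof.
move=> Gg x U nU; have [_ _ _ _ /(_ g x U Gg nU)[s [V [nV VP]]]] := Xflow.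
by rewrite nbhs_simpl; apply: filterS nV => y Vy /=; exact: VP.
Qed.

Lemma gflow_closed_core (S : set (T -> T)) (C : set X) :
  (forall g, S g -> G g) -> closed C ->
  closed [set x | forall g, S g -> C (act g x)].
Proof.
move=> SG Ccl; rewrite (_ : mkset _ = \bigcap_(g in S) act g @^-1` C).
  apply: closed_bigI => g /SG Gg; apply: preimage_closed => // x _.
  exact: gflow_continuous.
by apply/seteqP; split=> x /= xC g; exact: xC.
Qed.

Lemma ginvariant_core (C : set X) :
  ginvariant_set act [set x | forall g, G g -> C (act g x)].
Proof.
by move=> g x Gg xC h Gh; rewrite -gflow_actM//; apply/xC/permgroupM.
Qed.

Lemma ginvariant_closure (A : set X) :
  ginvariant_set act A -> ginvariant_set act (closure A).
Proof.
move=> Ainv g x Gg clx U nU.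
have [y [Ay Uy]] := clx _ (gflow_continuous Gg nU).
by exists (act g y); split=> //; exact: Ainv.
Qed.

Lemma gorbit_act g x : G g -> gorbit act (act g x) = gorbit act x.
Proof.
move=> Gg; apply/seteqP; split=> _ [h Gh ->].
  by exists (h \o g); [exact: permgroupM|rewrite gflow_actM].
have GgV := permgroupV Gg.
exists (h \o ginv g); first exact: permgroupM.
by rewrite gflow_actM// gflow_actK.
Qed.

Lemma gminimal_of_dense_orbits : [set: X] !=set0 ->
  (forall x, dense (gorbit act x)) -> gminimal act.
Proof.
move=> X0 orbit_dense; split=> // A Acl Ainv.
have [->|/set0P[x Ax]] := eqVneq A set0; [by left|right].
apply/seteqP; split=> // y _; apply: Acl => U Uy.
have [||z [/interior_subset Uz [g Gg zE]]] := orbit_dense x (interior U).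
- by exists y.
- exact: open_interior.
- by exists (act g x); split; [exact: Ainv|rewrite -zE].
Qed.

End FlowTheory.

Section MinimalFlowTheory.
Variables (X : topologicalType) (act : (T -> T) -> X -> X).
Hypothesis Xmin : gminimal act.

Lemma gminimal_flow : gflow act. Proof. by case: Xmin. Qed.

Lemma gminimal_closed (C : set X) x : closed C ->
  (forall g, G g -> C (act g x)) -> C = setT.
Proof.
move=> Ccl xC; pose A := [set x | forall g, G g -> C (act g x)].
have [_ _ /(_ A)[|||AT]] := Xmin.
- exact: (gflow_closed_core gminimal_flow (S := G)).
- exact: (ginvariant_core gminimal_flow).
- by move=> A0; have : A x := xC; rewrite A0.
apply/seteqP; split=> // y _; have : A y by rewrite AT.
by move=> /(_ id (permgroup1 G)); rewrite (gflow_act1 gminimal_flow).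
Qed.

Lemma gminimal_dense_orbit x : dense (gorbit act x).
Proof.
move=> U [y Uy] oU; apply: contrapT => noU.
have : ~` U = setT.
  apply: (@gminimal_closed _ x); first exact: open_closedC.
  by move=> g Gg Ug; apply: noU; exists (act g x); split=> //; exists g.
by move/seteqP => [_ /(_ y Logic.I)].
Qed.

End MinimalFlowTheory.

End Flow.

(** * Compact spaces *)

Lemma compact_bigcap_seq (X : ptopologicalType) (I : choiceType)
    (C : I -> set X) : compact [set: X] -> (forall i, closed (C i)) ->
  (forall s : seq I, exists x, forall i, i \in s -> C i x) ->
  \bigcap_i C i !=set0.
Proof.
move=> cX Ccl CP; move: cX; rewrite compact_In0 => /(_ _ setT C); apply.
  by exists C => // i _; rewrite setTI.
by move=> D _; have [x xP] := CP (finmap.enum_fset D); exists x.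
Qed.

Lemma compact_nbhs_sub (X : ptopologicalType) (T : choiceType)
    (B : seq T -> set X) (x : X) (U : set X) :
  compact [set: X] -> (forall s, closed (B s)) ->
  (forall s t, {subset s <= t} -> B t `<=` B s) ->
  (forall y, (forall s, B s y) -> y = x) -> nbhs x U -> exists s, B s `<=` U.
Proof.
move=> cX Bcl Banti Bx nU; apply: contrapT => /forallNP nB.
have [y yP] : \bigcap_s (B s `&` ~` interior U) !=set0.
  apply: compact_bigcap_seq => // [s|D].
    by apply: closedI => //; apply/open_closedC/open_interior.
  have /existsNP[y /not_implyP[By nUy]] := nB (flatten D).
  exists y => s sD; split; last by move=> /interior_subset.
  by apply: Banti By => a sa; apply/flattenP; exists s.
have yx : y = x by apply: Bx => s; case: (yP s Logic.I).
by case: (yP [::] Logic.I) => _; apply; rewrite yx.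
Qed.

Lemma countable_chain (I : countType) (P : Type) (le : P -> P -> Prop)
    (D : I -> P -> Prop) (p0 : P) :
  (forall p, le p p) -> (forall p q r, le p q -> le q r -> le p r) ->
  (forall i p, exists2 q, le p q & D i q) ->
  exists p : nat -> P, [/\ p 0 = p0, forall m n, m <= n -> le (p m) (p n)
    & forall i, exists n, D i (p n)].
Proof.
move=> le_refl le_trans Ddense.
have ex_next (x : nat * P) : exists q, le x.2 q /\
    forall i, unpickle x.1 = Some i -> D i q.
  case: (unpickle x.1) => [i|]; last by exists x.2.
  by have [q xq Dq] := Ddense i x.2; exists q; split=> // _ [<-].
have [next nextP] := choice ex_next.
pose p n := iteri n (fun k q => next (k, q)) p0.
exists p; split=> // [m|i]; last first.
  by exists (pickle i).+1; apply: (nextP (pickle i, _)).2; rewrite pickleK.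
elim=> [|n IHn]; first by rewrite leqn0 => /eqP ->.
rewrite leq_eqVlt => /predU1P[->//|/IHn mn].
by apply: le_trans mn _; exact: (nextP (n, p n)).1.
Qed.

Section CompactHausdorff.
Variable X : ptopologicalType.
Hypotheses (Xcompact : compact [set: X]) (Xhausdorff : hausdorff_space X).
Implicit Types A B V : set X.

Lemma open_shrink V : open V -> V !=set0 ->
  exists W, [/\ open W, W !=set0 & closure W `<=` V].
Proof.
move=> oV [x Vx].
have [W nW WV] := compact_regular Xhausdorff Xcompact
  (filterT : nbhs x setT) (open_nbhs_nbhs (conj oV Vx)).
exists (interior W); split; [exact: open_interior|by exists x|].
by apply: subset_trans WV; apply: closure_subset; exact: interior_subset.
Qed.

Lemma compact_Baire (U : nat -> set X) :
  (forall n, open (U n) /\ dense (U n)) -> dense (\bigcap_n U n).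
Proof.
move=> UP O O0 oO; have [V0 [oV0 V00 V0O]] := open_shrink oO O0.
pose P := {V : set X | open V /\ V !=set0}.
have [p [p0 p_mono pU]] : exists p : nat -> P, [/\ sval (p 0) = V0,
    forall m n, m <= n -> sval (p n) `<=` sval (p m)
    & forall i, exists n, closure (sval (p n)) `<=` U i].
  have [||i [V [oV V0']]|p [p0 ? ?]] := @countable_chain nat P
    (fun p q => sval q `<=` sval p) (fun i q => closure (sval q) `<=` U i)
    (exist _ V0 (conj oV0 V00)).
  - by move=> p.
  - by move=> p q r pq qr; exact: subset_trans pq.
  - have [oU dU] := UP i; have VU0 := dU _ V0' oV.
    have [W [oW W0 WVU]] := open_shrink (openI oV oU) VU0.
    exists (exist _ W (conj oW W0)) => /=; last by move=> x /WVU[].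
    by move=> x /subset_closure/WVU[].
  - by exists p; rewrite p0.
have [x xP] : \bigcap_n closure (sval (p n)) !=set0.
  apply: compact_bigcap_seq => // [n|s]; first exact: closed_closure.
  have [_ [x px]] := svalP (p (\max_(i <- s) i)); exists x => i si.
  by apply/subset_closure/(p_mono _ _ _ _ px); exact: leq_bigmax_seq.
exists x; split; first by apply: V0O; rewrite -p0; exact: xP.
by move=> i _; have [n] := pU i; apply; exact: xP.
Qed.

Lemma dense_G_deltaI A B : dense A -> G_delta A -> dense B -> G_delta B ->
  dense (A `&` B).
Proof.
move=> dA [U [oU AE]] dB [V [oV BE]]; rewrite AE BE -bigcapI.
have dense_factor C (W : nat -> set X) i : dense C -> C = \bigcap_n W n ->
    dense (W i).
  move=> dC CE O O0 oO; have [x [Ox Cx]] := dC O O0 oO.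
  by exists x; split=> //; rewrite CE in Cx; exact: Cx.
apply: compact_Baire => n; split; first exact: openI.
by apply: denseI => //; [exact: dense_factor AE|exact: dense_factor BE].
Qed.

End CompactHausdorff.

Lemma dense_G_delta_gorbit_unique (T : choiceType) (G : permgroup T)
    (X : ptopologicalType) (act : (T -> T) -> X -> X) (x y : X) :
  gflow G act ->
  dense (gorbit G act x) -> G_delta (gorbit G act x) ->
  dense (gorbit G act y) -> G_delta (gorbit G act y) ->
  gorbit G act y = gorbit G act x.
Proof.
move=> Xflow dx Gx dy Gy.
have [|z [_ [[g Gg zx] [h Gh zy]]]] := dense_G_deltaI (gflow_compact Xflow)
  (gflow_hausdorff Xflow) dx Gx dy Gy _ openT.
  by exists x.
by rewrite -(gorbit_act Xflow x Gg) -zx zy (gorbit_act Xflow).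
Qed.

Section SubFlow.
Variables (T : choiceType) (G : permgroup T) (X : topologicalType).
Variables (act : (T -> T) -> X -> X) (A : set X).
Hypotheses (Xflow : gflow G act) (Aclosed : closed A).
Hypothesis Ainv : ginvariant_set G act A.

Lemma compact_set_type : compact A -> compact [set: set_type A].
Proof.
move=> cA F PF _.
have FA : (set_val @ F) A.
  by rewrite /fmap /=; apply: filterS filterT => x _ /=; exact: set_valP.
have [x [Ax clx]] := cA (set_val @ F) _ FA.
exists (exist _ x (mem_set Ax)); split=> // B C FB [_ [[W oW <-] Wx WC]].
have [_ [[a Ba <-] Wa]] : set_val @` B `&` W !=set0.
  apply: clx; last exact: open_nbhs_nbhs.
  by rewrite /fmap /=; apply: filterS FB => a Ba /=; exists a.
by exists a; split=> //; exact: WC.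
Qed.

Lemma nbhs_set_type (x : set_type A) (U : set (set_type A)) : nbhs x U ->
  exists2 W, nbhs (set_val x) W & forall y, W (set_val y) -> U y.
Proof.
by move=> [_ [[W oW <-] Wx WU]]; exists W => //; exact: open_nbhs_nbhs.
Qed.

Lemma set_val_continuous : continuous (set_val : set_type A -> X).
Proof. exact: initial_continuous. Qed.

Definition sub_act (g : T -> T) (x : set_type A) : set_type A :=
  insubd x (act g (set_val x)).

Lemma set_val_sub_act g x : G g -> set_val (sub_act g x) = act g (set_val x).
Proof.
move=> Gg; rewrite !set_valE val_insubd mem_set//.
by apply: Ainv => //; exact: set_valP.
Qed.

Lemma sub_gflow : gflow G sub_act.
Proof.
have set_val_inj : injective (set_val : set_type A -> X).
  by move=> x y; rewrite !set_valE => /val_inj.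
have [cX hX act1 actM act_cont] := Xflow; split.
- by apply: compact_set_type; exact: subclosed_compact cX _.
- move=> x y xy; apply/set_val_inj/hX => B C xB yC.
  have [z [Bz Cz]] := xy _ _ (set_val_continuous xB) (set_val_continuous yC).
  by exists (set_val z).
- move=> x; apply: set_val_inj.
  by rewrite set_val_sub_act ?act1//; exact: permgroup1.
- move=> g h x Gg Gh; apply: set_val_inj.
  by rewrite (set_val_sub_act _ (permgroupM Gg Gh)) actM// !set_val_sub_act.
- move=> g x U Gg /nbhs_set_type[W + WU]; rewrite set_val_sub_act// => nW.
  have [s [V [nV VP]]] := act_cont g (set_val x) W Gg nW.
  exists s, (set_val @^-1` V); split; first exact: set_val_continuous.
  by move=> h y Gh hg Vy; apply: WU; rewrite set_val_sub_act//; exact: VP.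
Qed.

End SubFlow.

(** * The Ramsey property of a permutation group *)

Lemma image_set_seq (T : eqType) (g : T -> T) (s : seq T) :
  g @` [set` s] = [set` map g s].
Proof.
apply/seteqP; split=> x /=; first by case=> y ys <-; exact: map_f.
by case/mapP => y ys ->; exists y.
Qed.

Lemma set_seq_eq_mem (T : eqType) (s t : seq T) : [set` s] = [set` t] -> s =i t.
Proof.
by move=> st x; have := congr1 (fun A => `[< A x >]) st; rewrite /= !asboolb.
Qed.

Section RamseyGroup.
Variables (T : choiceType) (G : permgroup T).
Implicit Types (s t : seq T) (g h : T -> T).

Definition monochromatic (K : Type) (chi : set T -> K) s t :=
  exists k, forall g, G g -> {subset map g s <= t} -> chi [set` map g s] = k.

Definition ramsey_group := forall (K : finType) s t, exists c : seq T,
  forall chi : set T -> K,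
    exists h, [/\ G h, {subset map h t <= c} & monochromatic chi s (map h t)].

Lemma monochromatic_sub (K : Type) (chi : set T -> K) s t t' :
  {subset t' <= t} -> monochromatic chi s t -> monochromatic chi s t'.
Proof.
by move=> sub [k kP]; exists k => g Gg gs; apply: kP => // x /gs/sub.
Qed.

Lemma monochromatic_inj (K K' : Type) (f : K -> K') (chi : set T -> K) s t :
  injective f -> monochromatic (f \o chi) s t -> monochromatic chi s t.
Proof.
move=> f_inj [k kP].
have [[g0 [Gg0 g0s]]|none] := pselect (exists g, G g /\ {subset map g s <= t}).
  exists (chi [set` map g0 s]) => g Gg gs.
  by apply: f_inj; rewrite [LHS]kP// [RHS]kP.
by exists (chi set0) => g Gg gs; case: none; exists g.
Qed.

Lemma monochromatic_map (K : Type) (chi : set T -> K) s t h : G h ->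
  monochromatic (fun A => chi (h @` A)) s t -> monochromatic chi s (map h t).
Proof.
move=> Gh [k kP]; exists k => g Gg gs.
have -> : g = h \o (ginv h \o g) by apply/funext => x /=; rewrite (ginvKV Gh).
rewrite map_comp -image_set_seq; apply: kP.
  by apply: permgroupM => //; exact: permgroupV.
move=> _ /mapP[x xs ->]; have /mapP[y yt gx] := gs _ (map_f g xs).
by rewrite /= gx (ginvK Gh).
Qed.

Hypothesis ramseyG : ramsey_group.

Lemma ramsey_finite_family (K : finType) (I : eqType) (s : I -> seq T)
    (chi : I -> set T -> K) (l : seq I) t :
  exists2 h, G h & forall i, i \in l -> monochromatic (chi i) (s i) (map h t).
Proof.
elim: l t => [|i l IHl] t; first by exists id => //; exact: permgroup1.
have [c cP] := ramseyG K (s i) t; have [h Gh hP] := IHl c.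
have [h' [Gh' h't h'P]] := cP (fun A => chi i (h @` A)).
exists (h \o h'); first exact: permgroupM.
move=> j; rewrite inE map_comp => /predU1P[->{j}|/hP].
  exact: monochromatic_map h'P.
by apply: monochromatic_sub => _ /mapP[x xt ->]; apply/map_f/h't.
Qed.

Variables (X : ptopologicalType) (act : (T -> T) -> X -> X).
Hypothesis Xflow : gflow G act.

(* The colour [chi i] of a copy of [s i] decides a closed condition at [x0], so
   colourings that are constant on large finite sets give, by compactness, a
   point along whose orbit the conditions hold with colours fixed in advance. *)
Lemma ramsey_gflow (K : finType) (J : choiceType) (s : J -> seq T)
    (C : J -> K -> set X) (chi : J -> set T -> K) (x0 : X) :
  (forall i k, closed (C i k)) ->
  (forall i g, G g -> C i (chi i [set` map (ginv g) (s i)]) (act g x0)) ->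
  exists x, forall i, exists k, forall g, G g -> C i k (act g x).
Proof.
move=> Ccl CP.
pose S (p : J * seq T) g := G g /\ {subset map (ginv g) (s p.1) <= p.2}.
pose Q (p : J * seq T) : set X :=
  \bigcup_(k in [set: K]) [set x | forall g, S p g -> C p.1 k (act g x)].
have Qcl p : closed (Q p).
  apply: closed_bigcup => [|k _]; first exact: finite_finset.
  by apply: (gflow_closed_core Xflow) => // g [].
have [x xP] : \bigcap_p Q p !=set0.
  apply: compact_bigcap_seq (gflow_compact Xflow) Qcl _ => D.
  have [h Gh hP] :=
    ramsey_finite_family s chi (map fst D) (flatten (map snd D)).
  have GhV := permgroupV Gh; exists (act (ginv h) x0) => p pD.
  have [k kP] := hP p.1 (map_f _ pD); exists k => // g [Gg gs].
  have GghV : G (g \o ginv h) by exact: permgroupM.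
  rewrite -(gflow_actM Xflow)//; have := CP p.1 _ GghV.
  rewrite (ginvM Gg GhV) (ginvV Gh) kP//.
    by apply: permgroupM => //; exact: permgroupV.
  rewrite map_comp => _ /mapP[a /gs ap ->]; apply/map_f/flattenP.
  by exists p.2 => //; exact: map_f.
exists x => i; apply: contrapT => /forallNP noC.
have ex_g k : exists g, G g /\ ~ C i k (act g x).
  by have /existsNP[g /not_implyP] := noC k; exists g.
have [g gP] := choice ex_g.
have [k _ kP] :=
  xP (i, flatten [seq map (ginv (g k)) (s i) | k <- enum K]) Logic.I.
have [Ggk] := gP k; apply; apply: kP; split=> // a agk.
apply/flattenP; exists (map (ginv (g k)) (s i)) => //.
by apply/mapP; exists k; rewrite ?mem_enum.
Qed.

End RamseyGroup.

(** * Relations on a countable set *)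

Definition linear_order (T : eqType) (r : rel T) :=
  [/\ irreflexive r, transitive r & forall a b, a != b -> r a b || r b a].

Lemma linear_order_rev (T : eqType) (r : rel T) :
  linear_order r -> linear_order (fun a b => r b a).
Proof.
move=> [irr tr tot]; split=> // [b a c ba cb|a b ab]; first exact: tr cb ba.
by rewrite orbC tot.
Qed.

Definition conjugate_on (T : choiceType) (G : permgroup T) (s : seq T)
    (r r' : rel T) :=
  exists2 g, G g & map g s =i s /\ {in s &, forall a b, r a b = r' (g a) (g b)}.

Section ConjugateOn.
Variables (T : choiceType) (G : permgroup T) (s : seq T).
Implicit Types r : rel T.

Lemma conjugate_on_eq r1 r2 : {in s &, r1 =2 r2} -> conjugate_on G s r1 r2.
Proof. by move=> r12; exists id; [exact: permgroup1|rewrite map_id]. Qed.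

Lemma conjugate_on_sym r1 r2 : conjugate_on G s r1 r2 -> conjugate_on G s r2 r1.
Proof.
move=> [g Gg [gs r12]]; exists (ginv g); first exact: permgroupV.
have gVs a : a \in s -> ginv g a \in s.
  by rewrite -{1}(gs a) => /mapP[b sb ->]; rewrite (ginvK Gg).
split=> [a|a b sa sb]; last by rewrite r12 ?gVs// !(ginvKV Gg).
apply/mapP/idP => [[b sb ->]|sa]; first exact: gVs.
by exists (g a); [rewrite -(gs (g a)) map_f|rewrite (ginvK Gg)].
Qed.

Lemma conjugate_on_trans r2 r1 r3 : conjugate_on G s r1 r2 ->
  conjugate_on G s r2 r3 -> conjugate_on G s r1 r3.
Proof.
move=> [g Gg [gs r12]] [h Gh [hs r23]]; exists (h \o g).
  exact: permgroupM.
have gin a : a \in s -> g a \in s by move=> sa; rewrite -(gs (g a)) map_f.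
split=> [a|a b sa sb]; last by rewrite r12// r23 ?gin.
by rewrite map_comp -(hs a); apply: eq_mem_map.
Qed.

End ConjugateOn.

Definition relspace (T : Type) : Type := T -> T -> bool.

HB.instance Definition _ (T : Type) := Topological.copy (relspace T)
  (prod_topology (fun _ : T => prod_topology (fun _ : T => bool))).
HB.instance Definition _ (T : Type) :=
  isPointed.Build (relspace T) (fun _ _ : T => false).

Section RelSpace.
Variable T : choiceType.
Implicit Types (R P : relspace T) (s : seq T).

Lemma relspace_compact : compact [set: relspace T].
Proof.
have cT (X : T -> topologicalType) : (forall a, compact [set: X a]) ->
    compact [set: prod_topology X].
  move=> /(@tychonoff T X (fun _ => setT)).
  by congr compact; apply/seteqP; split.
apply: (cT (fun _ => prod_topology (fun _ : T => bool))) => _.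
by apply: cT => _; exact: bool_compact.
Qed.

Lemma relspace_hausdorff : hausdorff_space (relspace T).
Proof.
apply: (@hausdorff_product T (fun _ => prod_topology (fun _ : T => bool))) => _.
apply: (@hausdorff_product T (fun _ => bool)) => _.
exact: discrete_hausdorff.
Qed.

Lemma relspace_eval_continuous a b : continuous (fun R => R a b).
Proof.
move=> R; apply: (@continuous_comp (relspace T)
  (prod_topology (fun _ : T => bool)) bool (fun R => R a) (fun f => f b)).
  exact: proj_continuous.
exact: proj_continuous.
Qed.

Lemma relspace_near s R : nbhs R [set P | {in s &, R =2 P}].
Proof.
suff near_seq (l : seq (T * T)) :
    nbhs R [set P : relspace T | {in l, forall p, R p.1 p.2 = P p.1 p.2}].
  apply: filterS (near_seq [seq (a, b) | a <- s, b <- s]) => P RP a b sa sb.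
  by apply: (RP (a, b)); exact: allpairs_f.
elim: l => [|p l IHl]; first by apply: filterS filterT => P _ ?.
have np : nbhs R [set P : relspace T | R p.1 p.2 = P p.1 p.2].
  apply: (@relspace_eval_continuous p.1 p.2 R [set b | R p.1 p.2 = b]).
  by rewrite nbhs_principalE //=.
apply: filterS (filterI np IHl) => P [/= Rp Rl] q.
by rewrite inE => /predU1P[->|]; [|exact: Rl].
Qed.

Lemma relspace_closure (A : set (relspace T)) R s : closure A R ->
  exists2 P, A P & {in s &, R =2 P}.
Proof. by move=> /(_ _ (relspace_near s R))[P [AP RP]]; exists P. Qed.

Lemma relspace_closed s (Q : set (relspace T)) :
  (forall R P, {in s &, R =2 P} -> Q R -> Q P) -> closed Q.
Proof.
move=> Qs R /(relspace_closure s)[P QP RP].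
by apply: Qs QP => a b sa sb; rewrite RP.
Qed.

Lemma relspace_nbhs R (U : set (relspace T)) : nbhs R U ->
  exists s, [set P | {in s &, R =2 P}] `<=` U.
Proof.
apply: compact_nbhs_sub.
- exact: relspace_compact.
- move=> s; apply: (@relspace_closed s) => P Q PQ RP a b sa sb.
  by rewrite RP// PQ.
- by move=> s t st P RP a b /st sa /st sb; exact: RP.
- move=> P RP; apply/funext => a; apply/funext => b.
  by rewrite (RP [:: a; b])// !inE eqxx ?orbT.
Qed.

Lemma linear_order_closed : closed [set R : relspace T | linear_order R].
Proof.
rewrite (_ : mkset _ = \bigcap_(p in [set: T * T * T])
    [set R : relspace T | [/\ R p.1.1 p.1.1 = false,
      R p.1.2 p.1.1 -> R p.1.1 p.2 -> R p.1.2 p.2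
      & p.1.1 != p.1.2 -> R p.1.1 p.1.2 || R p.1.2 p.1.1]]).
  apply: closed_bigI => -[[a b] c] _ /=.
  apply: (@relspace_closed [:: a; b; c]) => R P RP /=.
  by rewrite !RP// !inE eqxx ?orbT.
apply/seteqP; split=> R /=.
  by move=> [irr tr tot] [[a b] c] _; split; [exact: irr|exact: tr|exact: tot].
move=> RP; split=> [a|b a c|a b].
- by have [] := RP (a, a, a) Logic.I.
- by have [] := RP (b, a, c) Logic.I.
- by have [] := RP (a, b, a) Logic.I.
Qed.

Variable G : permgroup T.
Implicit Types g h : T -> T.

Definition relact g R : relspace T := fun a b => R (ginv g a) (ginv g b).

Lemma relspace_gflow : gflow G relact.
Proof.
split.
- exact: relspace_compact.
- exact: relspace_hausdorff.
- by move=> R; rewrite /relact ginv1.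
- by move=> g h R Gg Gh; rewrite /relact (ginvM Gg Gh).
- move=> g R U Gg /relspace_nbhs[s sU]; pose t := map (ginv g) s.
  exists t, [set P | {in t &, R =2 P}].
  split; first exact: relspace_near.
  move=> h P Gh hg RP; apply: sU => a b sa sb.
  have hgV c : c \in s -> ginv h c = ginv g c.
    move=> sc; apply: (permgroup_inj Gh); rewrite (ginvKV Gh) hg ?map_f//.
    by rewrite (ginvKV Gg).
  by rewrite /relact !hgV// RP// map_f.
Qed.

Lemma linear_order_relact g R : G g -> linear_order R ->
  linear_order (relact g R).
Proof.
move=> Gg [irr tr tot]; split=> [a|b a c|a b ab]; [exact: irr|exact: tr|].
apply: tot; apply: contra ab => /eqP/(permgroup_inj (permgroupV Gg)) ->.
exact: eqxx.
Qed.

Lemma conjugate_on_relact s g h R : G g -> G h ->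
  map (ginv g) s =i map (ginv h) s ->
  conjugate_on G s (relact g R) (relact h R).
Proof.
move=> Gg Gh gh; exists (h \o ginv g).
  by apply: permgroupM => //; exact: permgroupV.
split=> [a|a b sa sb]; last by rewrite /relact /= !(ginvK Gh).
by rewrite map_comp (eq_mem_map _ gh) (map_ginvKV Gh).
Qed.

End RelSpace.

(** * The flow of uniform orders *)

Record equivariant_order (T : choiceType) (G : permgroup T)
    (M : topologicalType) (act : (T -> T) -> M -> M) (lt : M -> rel T) : Prop :=
    EquivariantOrder {
  eorder_open : forall a b, open [set m | lt m a b] ;
  eorder_linear : forall m, linear_order (lt m) ;
  eorder_act : forall g m a b, G g -> lt (act g m) (g a) (g b) = lt m a b ;
  eorder_conj : forall s m n, conjugate_on G s (lt m) (lt n) }.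

Lemma equivariant_order_rev (T : choiceType) (G : permgroup T)
    (M : topologicalType) (act : (T -> T) -> M -> M) (lt : M -> rel T) :
  equivariant_order G act lt -> equivariant_order G act (fun m a b => lt m b a).
Proof.
move=> [op lin ac cj]; split=> //.
- by move=> m; exact: linear_order_rev.
- by move=> g m a b Gg; exact: ac.
- move=> s m n; have [h Gh [hs hP]] := cj s m n; exists h => //.
  by split=> // a b sa sb; exact: hP.
Qed.

Lemma equivariant_order_comp (T : choiceType) (G : permgroup T)
    (M N : topologicalType) (actM : (T -> T) -> M -> M)
    (actN : (T -> T) -> N -> N) (f : M -> N) (lt : N -> rel T) :
  continuous f -> (forall g m, G g -> f (actM g m) = actN g (f m)) ->
  equivariant_order G actN lt -> equivariant_order G actM (lt \o f).
Proof.
move=> f_cont f_act [op lin ac cj]; split=> [a b|m|g m a b Gg|s m n] /=.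
- exact: (open_comp (fun m _ => f_cont m) (op a b)).
- exact: lin.
- by rewrite f_act// ac.
- exact: cj.
Qed.

Section OrderFlow.
Variables (T : countType) (G : permgroup T).
Hypothesis ramseyG : ramsey_group G.

Lemma uniform_order : exists2 R : relspace T, linear_order R &
  forall s g, G g -> conjugate_on G s (relact g R) R.
Proof.
pose R0 : relspace T := fun a b => (pickle a < pickle b)%N.
have R0_linear : linear_order R0.
  split=> [a|b a c|a b]; [exact: ltnn|exact: ltn_trans|].
  by rewrite /R0 -neq_ltn; apply: contra => /eqP/(pcan_inj pickleK) ->.
pose J := (seq T * relspace T)%type.
pose C (i : J) b : set (relspace T) :=
  [set R | linear_order R /\ `[< conjugate_on G i.1 R i.2 >] = b].
pose chi (i : J) (A : set T) : bool := `[< exists2 g, G g &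
  [set` map (ginv g) i.1] = A /\ conjugate_on G i.1 (relact g R0) i.2 >].
have [||R RP] := ramsey_gflow ramseyG (relspace_gflow G) (s := fst)
    (C := C) (chi := chi) (x0 := R0).
- move=> [s P] b; apply: closedI; first exact: linear_order_closed.
  apply: (@relspace_closed _ s) => R Q RQ /= <-; apply: asbool_equiv_eq.
  split=> RP; apply: (conjugate_on_trans _ RP); apply: conjugate_on_eq => //.
  by move=> a b' sa sb; rewrite RQ.
- move=> [s P] g Gg; split; first exact: (linear_order_relact Gg R0_linear).
  apply: asbool_equiv_eq; split=> [gP|]; first by exists g.
  move=> [h Gh [/set_seq_eq_mem hg hP]]; apply: (conjugate_on_trans _ hP).
  by apply: conjugate_on_relact => // a; rewrite hg.
have R1 : relact id R = R by rewrite /relact ginv1.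
exists R.
  by have [b /(_ _ (permgroup1 G))[]] := RP ([::], R); rewrite R1.
move=> s g Gg; have [b bP] := RP (s, R); apply/asboolP.
have [_ ->] := bP g Gg; have [_ <-] := bP id (permgroup1 G).
by rewrite R1; apply/asboolP/conjugate_on_eq.
Qed.

Section OrderHull.
Variable R : relspace T.
Hypotheses (R_linear : linear_order R)
  (R_conj : forall s g, G g -> conjugate_on G s (relact g R) R).

Definition order_hull : set (relspace T) := closure (gorbit G (@relact T) R).

Lemma order_hull_inv : ginvariant_set G (@relact T) order_hull.
Proof.
apply: (ginvariant_closure (relspace_gflow G)) => // g _ Gg [h Gh ->].
exists (g \o h); first exact: permgroupM.
by rewrite (gflow_actM (relspace_gflow G)).
Qed.

Lemma order_hull_linear P : order_hull P -> linear_order P.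
Proof.
move=> hullP; apply: linear_order_closed.
apply: closure_subset hullP => _ [g Gg ->].
exact: linear_order_relact Gg R_linear.
Qed.

Lemma order_hull_conj s P Q : order_hull P -> order_hull Q ->
  conjugate_on G s P Q.
Proof.
have conjR P' : order_hull P' -> conjugate_on G s P' R.
  move=> /(relspace_closure s)[_ [g Gg ->] Pg].
  by apply: conjugate_on_trans (R_conj s Gg); exact: conjugate_on_eq.
by move=> /conjR PR /conjR/conjugate_on_sym; exact: conjugate_on_trans.
Qed.

Definition hull_act := sub_act (@relact T) (A := order_hull).

Lemma hull_minimal : gminimal G hull_act.
Proof.
apply: gminimal_of_dense_orbits.
- apply: (sub_gflow (relspace_gflow G)); first exact: closed_closure.
  exact: order_hull_inv.
- have hullR : order_hull R.
    apply: subset_closure; exists id; first exact: permgroup1.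
    by rewrite (gflow_act1 (relspace_gflow G)).
  by exists (exist _ R (mem_set hullR)).
- move=> P U [Q UQ] oU.
  have [W + WU] := nbhs_set_type (open_nbhs_nbhs (conj oU UQ)).
  move=> /relspace_nbhs[s sW].
  have [g Gg [_ QP]] := order_hull_conj s (set_valP Q) (set_valP P).
  have GgV := permgroupV Gg; exists (hull_act (ginv g) P).
  split; last by exists (ginv g).
  apply: WU; rewrite (set_val_sub_act order_hull_inv)//; apply: sW => a b sa sb.
  by rewrite /relact (ginvV Gg); exact: QP.
Qed.

Lemma hull_equivariant_order :
  equivariant_order G hull_act (set_val : set_type order_hull -> relspace T).
Proof.
split.
- move=> a b; apply: (open_comp (D := [set c : bool | c])).
    move=> P _; apply: (@continuous_comp _ (relspace T) _ set_val
      (fun R => R a b)); first exact: set_val_continuous.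
    exact: relspace_eval_continuous.
  exact: discrete_open.
- by move=> P; exact/order_hull_linear/set_valP.
- move=> g P a b Gg; rewrite (set_val_sub_act order_hull_inv)//.
  by rewrite /relact !(ginvK Gg).
- by move=> s P Q; apply: order_hull_conj; exact: set_valP.
Qed.

End OrderHull.

Lemma exists_order_flow : exists (Y : topologicalType)
  (act : (T -> T) -> Y -> Y) (lt : Y -> rel T),
  gminimal G act /\ equivariant_order G act lt.
Proof.
have [R R_linear R_conj] := uniform_order.
exists (set_type (order_hull R)), (@hull_act R), set_val.
by split; [exact: hull_minimal|exact: hull_equivariant_order].
Qed.

End OrderFlow.

(** * Increasing lists *)

Lemma sorted_map_in (T : eqType) (r r' : rel T) (g : T -> T) (l : seq T) :
  {in l &, forall a b, r a b = r' (g a) (g b)} ->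
  sorted r' (map g l) = sorted r l.
Proof.
move=> rr'; rewrite sorted_map.
apply: (@eq_in_sorted _ (mem l)); last exact/allP.
by move=> a b al bl; rewrite /= rr'.
Qed.

Section LinearOrder.
Variables (T : eqType) (r : rel T).
Hypothesis r_linear : linear_order r.
Implicit Types (a b : T) (l k s p q : seq T).

Lemma linear_irr : irreflexive r. Proof. by case: r_linear. Qed.

Lemma linear_trans : transitive r. Proof. by case: r_linear. Qed.

Lemma linear_total a b : a != b -> r a b || r b a.
Proof. by case: r_linear => _ _; apply. Qed.

Lemma linear_asym a b : r a b -> ~~ r b a.
Proof. by move=> ab; apply/negP => /(linear_trans ab); rewrite linear_irr. Qed.

Lemma linear_sorted_uniq l : sorted r l -> uniq l.
Proof. exact: sorted_uniq linear_trans linear_irr _. Qed.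

Lemma linear_sorted_notin p q a : sorted r (p ++ a :: q) -> a \notin p ++ q.
Proof.
by move=> /linear_sorted_uniq; rewrite -cat1s uniq_catCA cat1s /= => /andP[].
Qed.

Lemma linear_sorted_eq l k : l =i k -> sorted r l -> sorted r k -> l = k.
Proof. by move=> lk sl sk; apply: (irr_sorted_eq linear_trans linear_irr). Qed.

Lemma linear_sorted_insert l b : b \notin l -> sorted r l ->
  exists k1 k2, l = k1 ++ k2 /\ sorted r (k1 ++ b :: k2).
Proof.
elim: l => [|a l IHl]; first by exists [::], [::].
rewrite inE negb_or => /andP[ba bl] sal.
have := sal; rewrite /= (path_sortedE linear_trans) => /andP[al sl].
have [lba|nlba] := boolP (r b a).
  by exists [::], (a :: l); rewrite /= lba.
have ab : r a b by have := linear_total ba; rewrite (negbTE nlba).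
have [k1 [k2 [lE sk]]] := IHl bl sl.
exists (a :: k1), k2; rewrite lE; split=> //.
rewrite cat_cons /= (path_sortedE linear_trans) sk andbT.
by move: al; rewrite lE !all_cat /= ab => /andP[-> ->].
Qed.

Lemma exists_linear_sorted s : exists2 l, sorted r l & l =i s.
Proof.
elim: s => [|a s [l sl ls]]; first by exists [::].
have [al|al] := boolP (a \in l).
  by exists l => // b; rewrite inE ls; case: eqP => // ->; rewrite -ls al.
have [k1 [k2 [lE sk]]] := linear_sorted_insert al sl.
by exists (k1 ++ a :: k2) => // b; rewrite mem_cat !inE -ls lE mem_cat orbCA.
Qed.

Lemma linear_sorted_index l : sorted r l ->
  {in l &, forall a b, r a b = (index a l < index b l)%N}.
Proof.
move=> sl a b al bl.
have index_lt c d : c \in l -> d \in l -> (index c l < index d l)%N -> r c d.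
  by move=> cl dl; exact: (sorted_ltn_index linear_trans).
apply/idP/idP => [ab|]; last exact: index_lt.
rewrite ltnNge leq_eqVlt; apply/negP => /orP[/eqP ba|/(index_lt _ _ bl al)].
  have ab' : b = a by rewrite -(nth_index a bl) ba nth_index.
  by move: ab; rewrite ab' linear_irr.
by apply/negP/linear_asym.
Qed.

Lemma linear_increasing_id s (g : T -> T) : map g s =i s ->
  {in s &, forall a b, r a b = r (g a) (g b)} -> {in s, g =1 id}.
Proof.
move=> gs gP; have [l sl ls] := exists_linear_sorted s.
suff gl : map g l = map id l.
  by move=> a; rewrite -ls => al; exact: (eq_in_map _ _ _).2 gl _ al.
rewrite map_id; apply: linear_sorted_eq => // [a|].
  by rewrite (eq_mem_map _ ls) gs ls.
by rewrite (@sorted_map_in _ r)// => a b; rewrite !ls; exact: gP.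
Qed.

Lemma linear_sorted_between p q l : sorted r (p ++ q) -> sorted r l ->
  (forall a, a \in l -> sorted r (p ++ a :: q)) -> sorted r (p ++ l ++ q).
Proof.
rewrite !(sorted_pairwise linear_trans) !pairwise_cat => /and3P[pq pp qq] ll lP.
have aP a : a \in l -> all (r ^~ a) p /\ all (r a) q.
  move=> /lP; rewrite (sorted_pairwise linear_trans) pairwise_cat allrel_consr.
  by move=> /and3P[/andP[pa _] _ /andP[aq _]].
rewrite allrel_catr pq pp qq ll !andbT /=; apply/andP; split.
  by apply/allrelP => b a bp /aP[/allP/(_ b bp)].
by apply/allrelP => a b /aP[_ /allP aq] /aq.
Qed.

End LinearOrder.

Lemma sorted_agree (T : eqType) (r r' : rel T) (l : seq T) :
  linear_order r -> linear_order r' -> sorted r l -> sorted r' l ->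
  {in l &, r =2 r'}.
Proof.
move=> lr lr' rl r'l a b al bl.
by rewrite (linear_sorted_index lr rl)// (linear_sorted_index lr' r'l).
Qed.

Lemma agree_sorted (T : eqType) (r r' : rel T) (s l : seq T) :
  {in s &, r =2 r'} -> {subset l <= s} -> sorted r l = sorted r' l.
Proof.
by move=> rr' ls; apply: (@eq_in_sorted _ (mem s)) => //; exact/allP.
Qed.

Section Cylinders.
Variables (T : choiceType) (G : permgroup T) (M : topologicalType).
Variables (act : (T -> T) -> M -> M) (lt : M -> rel T).
Hypothesis O : equivariant_order G act lt.
Implicit Types (m n : M) (a b : T) (l k s : seq T) (g h : T -> T).

Definition cyl l : set M := [set m | sorted (lt m) l].

Definition order_class s n : set M := [set m | {in s &, lt m =2 lt n}].

Let lt_linear m : linear_order (lt m). Proof. exact: eorder_linear O m. Qed.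

Lemma cyl_act g m l : G g -> cyl (map g l) (act g m) = cyl l m.
Proof.
move=> Gg; rewrite /cyl /= sorted_map; congr is_true.
apply: eq_sorted => a b /=.
by rewrite /relpre /= (eorder_act O).
Qed.

Lemma cyl_ginv g m l : G g -> cyl l (act g m) = cyl (map (ginv g) l) m.
Proof. by move=> Gg; rewrite -{1}(map_ginvKV Gg l) cyl_act. Qed.

Lemma cyl_subseq l k : subseq k l -> cyl l `<=` cyl k.
Proof.
by move=> kl m; exact: (subseq_sorted (@linear_trans _ _ (lt_linear m)) kl).
Qed.

Lemma conjugate_cyl m n l k : l =i k -> cyl l m -> cyl k n -> conjugate G l k.
Proof.
move=> lk sl sk; have [h Gh [hl hP]] := eorder_conj O l m n.
exists h => //; apply: (linear_sorted_eq (lt_linear n)) => //.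
  by move=> a; rewrite hl.
by rewrite (sorted_map_in hP).
Qed.

Lemma cyl_cons a b l : cyl [:: a, b & l] = [set m | lt m a b] `&` cyl (b :: l).
Proof. by apply/seteqP; split=> m /=; rewrite /cyl /= => /andP. Qed.

Lemma cyl_small l : (size l <= 1)%N -> cyl l = setT.
Proof. by case: l => [|a []]// _; apply/seteqP; split. Qed.

Lemma cyl_open l : open (cyl l).
Proof.
elim: l => [|a [|b l] IHl]; [by rewrite cyl_small//; exact: openT..|].
by rewrite cyl_cons; apply: openI => //; exact: eorder_open O _ _.
Qed.

Lemma lt_closed a b : closed [set m | lt m a b].
Proof.
have [->|ab] := eqVneq a b.
  rewrite (_ : mkset _ = set0); first exact: closed0.
  by apply/seteqP; split=> m //=; rewrite (linear_irr (lt_linear m)).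
rewrite (_ : mkset _ = ~` [set m | lt m b a]).
  by apply/open_closedC; exact: eorder_open O _ _.
apply/seteqP; split=> m /= mab; first exact/negP/(linear_asym (lt_linear m)).
by have := linear_total (lt_linear m) ab; case: (lt m a b) => //= /mab.
Qed.

Lemma cyl_closed l : closed (cyl l).
Proof.
elim: l => [|a [|b l] IHl]; [by rewrite cyl_small//; exact: closedT..|].
by rewrite cyl_cons; apply: closedI => //; exact: lt_closed.
Qed.

Lemma order_class_cyl n s : exists2 l, cyl l n & order_class s n = cyl l.
Proof.
have [l sl ls] := exists_linear_sorted (lt_linear n) s; exists l => //.
apply/seteqP; split=> m mP.
  by rewrite /cyl /= (agree_sorted mP)// => a; rewrite ls.
move=> a b; rewrite -!ls.
exact: sorted_agree (lt_linear m) (lt_linear n) mP sl a b.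
Qed.

Lemma order_class_open s n : open (order_class s n).
Proof. by have [l _ ->] := order_class_cyl n s; exact: cyl_open. Qed.

Lemma order_class_closed s n : closed (order_class s n).
Proof. by have [l _ ->] := order_class_cyl n s; exact: cyl_closed. Qed.

Lemma order_class_fixes s n m g : G g -> map g s =i s ->
  order_class s n m -> order_class s n (act g m) -> {in s, g =1 id}.
Proof.
move=> Gg gs mn gmn.
apply: (linear_increasing_id (lt_linear n)) => // a b sa sb.
have gin c : c \in s -> g c \in s by move=> sc; rewrite -(gs (g c)) map_f.
by rewrite -(mn _ _ sa sb) -(gmn _ _ (gin _ sa) (gin _ sb)) (eorder_act O).
Qed.

End Cylinders.

(** * The order determines the point of a minimal flow *)

Section MinimalFlow.
Variables (T : countType) (G : permgroup T) (M : ptopologicalType).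
Variables (act : (T -> T) -> M -> M) (lt : M -> rel T).
Hypotheses (Mmin : gminimal G act) (O : equivariant_order G act lt).
Hypothesis ramseyG : ramsey_group G.
Implicit Types (m n : M) (a b : T) (l k s : seq T) (g h : T -> T).

Let Mflow : gflow G act. Proof. exact: gminimal_flow Mmin. Qed.

(* A copy of [s] is coloured by the position of the base point in the frame in
   which the copy carries the order of [n]: this frame is unique over [s]. *)
Lemma order_class_dichotomy s n (V C : set M) : open V -> closed C ->
  (forall h m, fixator G s h -> V m -> C (act h m)) ->
  order_class lt s n `<=` C \/ order_class lt s n `<=` ~` V.
Proof.
move=> oV cC VC; pose P := order_class lt s n.
pose E (_ : unit) (c : bool) := ~` P `|` (if c then C else ~` V).
have Ecl i c : closed (E i c).
  apply: closedU; first exact/open_closedC/(order_class_open O).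
  by case: c => //; exact: open_closedC.
pose chi (_ : unit) (S : set T) : bool := `[< exists2 g, G g &
  [/\ [set` map (ginv g) s] = S, P (act g point) & V (act g point)] >].
have [|m mP] := ramsey_gflow ramseyG Mflow (s := fun=> s) (chi := chi)
    (x0 := point) Ecl.
  move=> i g Gg; have [Pg|] := pselect (P (act g point)); [right|by left].
  rewrite /chi; case: asboolP => [|nV /=]; last first.
    by move=> Vg; apply: nV; exists g.
  move=> [h Gh [/set_seq_eq_mem hg Ph Vh]]; have GhV := permgroupV Gh.
  have gh : act g point = act (g \o ginv h) (act h point).
    by rewrite (gflow_actM Mflow _ Gg GhV) (gflow_actK Mflow Gh).
  have Ggh : G (g \o ginv h) by exact: permgroupM.
  rewrite gh; apply: VC => //; split=> //.
  apply: (order_class_fixes O Ggh _ Ph) => [a|]; last by rewrite -gh.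
  by rewrite map_comp (eq_mem_map _ hg) (map_ginvKV Gg).
have [c cP] := mP tt.
have all_E x : E tt c x by rewrite (gminimal_closed Mmin (Ecl tt c) cP).
by case: c {cP} all_E => all_E; [left|right] => x Px; case: (all_E x).
Qed.

Lemma eorder_inj m n : lt m =2 lt n -> m = n.
Proof.
move=> mn; apply: contrapT => /eqP mNn.
have [_ + act1 _ act_cont] := Mflow; rewrite open_hausdorff => Mh.
have [[U1 U2] /= [/set_mem U1m /set_mem U2n] [oU1 oU2 U12]] := Mh _ _ mNn.
have U1C : nbhs (act id m) (~` U2).
  rewrite act1; apply: filterS (open_nbhs_nbhs (conj oU1 U1m)) => x U1x U2x.
  by suff : (U1 `&` U2) x; [rewrite (eqP U12)|].
have [s [V [nV VP]]] := act_cont id m _ (permgroup1 G) U1C.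
have [|||all_C|all_V] := @order_class_dichotomy s n (interior V) (~` U2).
- exact: open_interior.
- exact: open_closedC.
- by move=> h x [Gh hs] /interior_subset; exact: VP.
- exact: (all_C n).
- by apply: (all_V m) => // a b _ _; exact: mn.
Qed.

Lemma cyl_nbhs_base m (U : set M) : nbhs m U ->
  exists2 l, cyl lt l m & cyl lt l `<=` U.
Proof.
move=> nU; have [s sU] : exists s, order_class lt s m `<=` U.
  apply: (compact_nbhs_sub (gflow_compact Mflow) _ _ _ nU).
  - by move=> s; exact: order_class_closed O _ _.
  - by move=> s t st n tn a b /st sa /st sb; exact: tn.
  - move=> n nm; apply: eorder_inj => a b.
    by apply: (nm [:: a; b]); rewrite !inE eqxx ?orbT.
by have [l lm lE] := order_class_cyl O m s; exists l; rewrite -?lE.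
Qed.

End MinimalFlow.

(** * Generic points *)

Definition closed_permgroup (T : choiceType) (G : permgroup T) :=
  forall f : T -> T, bijective f ->
    (forall s : seq T, exists2 h, G h & {in s, h =1 f}) -> G f.

Section Extensions.
Variables (T : countType) (G : permgroup T) (M : topologicalType).
Variables (act : (T -> T) -> M -> M) (lt : M -> rel T).
Hypothesis O : equivariant_order G act lt.
Implicit Types (m n : M) (a b v : T) (l k s : seq T) (g h : T -> T).

Definition extends l1 b l2 : set M := [set m |
  cyl lt (l1 ++ l2) m -> cyl lt (l1 ++ b :: l2) !=set0 ->
  exists2 v, conjugate G (l1 ++ b :: l2) (l1 ++ v :: l2) &
    cyl lt (l1 ++ v :: l2) m].

Definition generic : set M := [set m | forall l1 b l2, extends l1 b l2 m].

Lemma extends_open l1 b l2 : open (extends l1 b l2).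
Proof.
have [ne|empty] := pselect (cyl lt (l1 ++ b :: l2) !=set0); last first.
  rewrite (_ : extends _ _ _ = setT); first exact: openT.
  by apply/seteqP; split=> m // _ _ /empty.
rewrite (_ : extends _ _ _ = ~` cyl lt (l1 ++ l2) `|`
  \bigcup_(v in [set v | conjugate G (l1 ++ b :: l2) (l1 ++ v :: l2)])
    cyl lt (l1 ++ v :: l2)).
  apply: openU; first exact/closed_openC/(cyl_closed O).
  by apply: bigcup_open => v _; exact: cyl_open O _.
apply/seteqP; split=> m /=.
  move=> mP; have [ml|] := pselect (cyl lt (l1 ++ l2) m); last by left.
  by right; have [v bv vm] := mP ml ne; exists v.
by case=> [nm /nm//|[v bv vm]] _ _; exists v.
Qed.

Lemma generic_bigcap : generic = \bigcap_i
  (if unpickle i is Some (l1, b, l2) then extends l1 b l2 else setT).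
Proof.
apply/seteqP; split=> m mP /=.
  by move=> i _; case: unpickle => // -[[l1 b] l2]; exact: mP.
by move=> l1 b l2; have := mP (pickle (l1, b, l2)) Logic.I; rewrite pickleK.
Qed.

Lemma generic_G_delta : G_delta generic.
Proof.
exists (fun i : nat =>
  if unpickle i is Some (l1, b, l2) then extends l1 b l2 else setT).
split; last exact: generic_bigcap.
by move=> i; case: unpickle => [[[l1 b] l2]|];
  [exact: extends_open|exact: openT].
Qed.

Lemma generic_inv : ginvariant_set G act generic.
Proof.
move=> g m Gg gm l1 b l2; have GgV := permgroupV Gg; set gV := map (ginv g).
have conj_gV l : conjugate G l (gV l) by exists (ginv g).
move=> + [n nl]; rewrite (cyl_ginv O)// map_cat => ml.
have [|v bv vm] := gm (gV l1) (ginv g b) (gV l2) ml.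
  by exists (act (ginv g) n); rewrite -map_cons -map_cat (cyl_act O).
exists (g v); last by rewrite (cyl_ginv O)// map_cat /= (ginvK Gg).
apply: (conjugate_trans (conj_gV _)); rewrite /gV map_cat /=.
apply: (conjugate_trans bv); apply: conjugate_sym.
by have := conj_gV (l1 ++ g v :: l2); rewrite /gV map_cat /= (ginvK Gg).
Qed.

End Extensions.

Lemma unzip_graph (T : eqType) (g : T -> T) (p : seq (T * T)) a c :
  map g (unzip1 p) = unzip2 p -> (a, c) \in p -> c = g a.
Proof.
elim: p => //= -[a' c'] p IHp [ga' /IHp IH].
by rewrite inE => /predU1P[[-> ->]|].
Qed.

Section BackAndForth.
Variables (T : countType) (G : permgroup T) (M : ptopologicalType).
Variables (act : (T -> T) -> M -> M) (lt : M -> rel T).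
Hypotheses (Mmin : gminimal G act) (O : equivariant_order G act lt).
Hypotheses (ramseyG : ramsey_group G) (Gclosed : closed_permgroup G).
Implicit Types (m n : M) (a b c d : T) (p q : seq (T * T)) (g h : T -> T).

Definition partial_iso m n p := [/\ conjugate G (unzip1 p) (unzip2 p),
  cyl lt (unzip1 p) m & cyl lt (unzip2 p) n].

Lemma partial_iso_swap m n p : partial_iso m n p ->
  partial_iso n m (map swap_pair p).
Proof.
have unzip1_swap : unzip1 (map swap_pair p) = unzip2 p.
  by rewrite /unzip1 -map_comp.
have unzip2_swap : unzip2 (map swap_pair p) = unzip1 p.
  by rewrite /unzip2 -map_comp.
by rewrite /partial_iso unzip1_swap unzip2_swap => -[/conjugate_sym].
Qed.

Lemma partial_iso_lt m n p a b c d : partial_iso m n p ->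
  (a, c) \in p -> (b, d) \in p -> lt n c d = lt m a b.
Proof.
move=> [[g Gg gp] mp np] ac bd.
have in2 x y : (x, y) \in p -> y \in unzip2 p by exact: (map_f snd).
have gmp : cyl lt (unzip2 p) (act g m) by rewrite -gp (cyl_act O).
rewrite (sorted_agree (eorder_linear O n) (eorder_linear O _) np gmp).
- by rewrite (unzip_graph gp ac) (unzip_graph gp bd) (eorder_act O).
- exact: in2 ac.
- exact: in2 bd.
Qed.

Lemma partial_iso_forth m n p a : generic G lt n -> partial_iso m n p ->
  exists q, [/\ partial_iso m n q, {subset p <= q} & a \in unzip1 q].
Proof.
move=> gn pP; have [[g Gg gp] mp np] := pP.
have [ap|ap] := boolP (a \in unzip1 p); first by exists p; split.
have [k1 [k2 [pE mk]]] := linear_sorted_insert (eorder_linear O m) ap mp.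
pose p1 := take (size k1) p; pose p2 := drop (size k1) p.
have p12 : p = p1 ++ p2 by rewrite cat_take_drop.
have p1E : unzip1 p1 = k1 by rewrite /unzip1 map_take -/unzip1 pE take_size_cat.
have p2E : unzip1 p2 = k2 by rewrite /unzip1 map_drop -/unzip1 pE drop_size_cat.
have [g1 g2] : map g k1 = unzip2 p1 /\ map g k2 = unzip2 p2.
  move: gp; rewrite pE map_cat p12 /unzip2 map_cat => /eqP.
  by rewrite eqseq_cat -?p1E ?size_map// => /andP[/eqP ? /eqP].
have conjg : conjugate G (k1 ++ a :: k2) (unzip2 p1 ++ g a :: unzip2 p2).
  by exists g; rewrite // map_cat /= g1 g2.
have [||v bv vn] := gn (unzip2 p1) (g a) (unzip2 p2).
- by rewrite /unzip2 -map_cat -p12.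
- by exists (act g m); rewrite -g1 -g2 -map_cons -map_cat (cyl_act O).
exists (p1 ++ (a, v) :: p2); split.
- rewrite /partial_iso /unzip1 /unzip2 !map_cat /=.
  rewrite -/(unzip1 p1) -/(unzip1 p2) p1E p2E.
  by split=> //; exact: conjugate_trans bv.
- by move=> x; rewrite p12 !mem_cat inE => /orP[] ->; rewrite ?orbT.
- by rewrite /unzip1 map_cat mem_cat mem_head orbT.
Qed.

Lemma partial_iso_back m n p c : generic G lt m -> partial_iso m n p ->
  exists q, [/\ partial_iso m n q, {subset p <= q} & c \in unzip2 q].
Proof.
move=> gm /partial_iso_swap/(partial_iso_forth c gm)[q [qP pq cq]].
exists (map swap_pair q); split; first exact: partial_iso_swap.
  by move=> x xp; rewrite -[x]swap_pairK map_f// pq// map_f.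
by rewrite /unzip2 -map_comp.
Qed.

Lemma partial_iso_limit m n (p : nat -> seq (T * T)) :
  (forall i, partial_iso m n (p i)) ->
  (forall i j, i <= j -> {subset p i <= p j}) ->
  (forall a, exists i, a \in unzip1 (p i)) ->
  (forall c, exists i, c \in unzip2 (p i)) ->
  exists2 f, G f & forall a b, lt n (f a) (f b) = lt m a b.
Proof.
move=> pP p_mono p_dom p_ran.
have ex_f a : exists c, exists i, (a, c) \in p i.
  by have [i /mapP[[a' c] ac ->]] := p_dom a; exists c, i.
have [f fP] := choice ex_f.
have graph i : exists2 g, G g & forall a c, (a, c) \in p i -> c = g a.
  by have [[g Gg gp] _ _] := pP i; exists g => // a c; exact: unzip_graph gp.
have f_seq (s : seq T) : exists i, forall a, a \in s -> (a, f a) \in p i.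
  elim: s => [|a s [i si]]; first by exists 0%N.
  have [j aj] := fP a; exists (maxn i j) => b.
  rewrite inE => /predU1P[->|/si bi].
    exact: p_mono (leq_maxr i j) _ aj.
  exact: p_mono (leq_maxl i j) _ bi.
have Gf : G f.
  apply: Gclosed => [|s]; last first.
    have [i si] := f_seq s; have [g Gg gP] := graph i.
    by exists g => // a /si/gP.
  have f_inj : injective f.
    move=> a b fab; have [i abi] := f_seq [:: a; b]; have [g Gg gP] := graph i.
    apply: (permgroup_inj Gg); rewrite -(gP a (f a)) ?abi ?inE ?eqxx//.
    by rewrite fab (gP b (f b)) ?abi ?inE ?eqxx ?orbT.
  have f_surj c : exists a, f a = c.
    have [i /mapP[[a c'] ac ->]] := p_ran c; have [j aj] := fP a.
    have [g _ gP] := graph (maxn i j); exists a.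
    rewrite (gP _ _ (p_mono _ _ (leq_maxr i j) _ aj)).
    by rewrite [RHS](gP _ _ (p_mono _ _ (leq_maxl i j) _ ac)).
  have [f' f'K] := choice f_surj.
  by exists f' => // a; apply: f_inj; rewrite f'K.
exists f => // a b; have [i abi] := f_seq [:: a; b].
by apply: (partial_iso_lt (pP i)); apply: abi; rewrite !inE eqxx ?orbT.
Qed.

Lemma generic_sub_gorbit m n : generic G lt m -> generic G lt n ->
  gorbit G act m n.
Proof.
move=> gm gn; pose P := {p | partial_iso m n p}.
have p0 : partial_iso m n [::] by split=> //; exact: conjugate_refl.
have [|||p [_ p_mono p_ext]] := @countable_chain T P
  (fun x y => {subset sval x <= sval y})
  (fun a x => a \in unzip1 (sval x) /\ a \in unzip2 (sval x)) (exist _ [::] p0).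
- by move=> x a.
- by move=> x y z xy yz a /xy/yz.
- move=> a [q qP]; have [q1 [q1P q_q1 aq1]] := partial_iso_forth a gn qP.
  have [q2 [q2P q1_q2 aq2]] := partial_iso_back a gm q1P.
  exists (exist _ q2 q2P) => /=; first by move=> x /q_q1/q1_q2.
  by split=> //; have /mapP[x /q1_q2 xq2 ->] := aq1; exact: map_f.
have [|||f Gf fP] := @partial_iso_limit m n (fun i => sval (p i)) _ p_mono.
- by move=> i; exact: svalP (p i).
- by move=> a; have [i []] := p_ext a; exists i.
- by move=> a; have [i []] := p_ext a; exists i.
exists f => //; apply: (eorder_inj Mmin O ramseyG) => a b.
by rewrite -[a](ginvKV Gf) -[b](ginvKV Gf) fP (eorder_act O).
Qed.

End BackAndForth.

(** * Invariant measures *)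

Section Probability.
Context d (S : measurableType d) (R : realType) (P : probability S R).

Lemma sum_measure_le_count (I : eqType) (e : seq I) (Q : I -> set S)
    (k : nat) :
  (forall i, i \in e -> measurable (Q i)) ->
  (forall x, count (fun i => x \in Q i) e <= k)%N ->
  (\sum_(i <- e) P (Q i) <= k%:R%:E)%E.
Proof.
move=> mQ Qk; pose Q' i := if i \in e then Q i else set0.
have mQ' i : measurable (Q' i) by rewrite /Q'; case: ifP => // /mQ.
rewrite (eq_big_seq (fun i => \int[P]_x (\1_(Q' i) x)%:E)%E); last first.
  by move=> i ie; rewrite integral_indic// setIT /Q' ie.
rewrite -ge0_integral_sum//; last first.
  by move=> i; apply/measurable_EFinP; exact: measurable_indic.
have -> : (k%:R%:E = \int[P]_x (k%:R)%:E :> \bar R)%E.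
  rewrite integral_cst// -[LHS]mule1; congr (_ * _)%E.
  by rewrite -(probability_setT P).
apply: ge0_le_integral => // [x _||x _].
- by apply: sume_ge0 => i _; rewrite lee_fin.
- apply: emeasurable_sum => i; apply/measurable_EFinP.
  exact: measurable_indic.
rewrite sumEFin lee_fin.
apply: le_trans (_ : (count (fun i => x \in Q i) e)%:R <= _)%R.
  rewrite -sum1_count natr_sum [leRHS]big_mkcond /= big_seq [leRHS]big_seq.
  by apply: ler_sum => i ie; rewrite /Q' ie indicE; case: ifP.
by rewrite ler_nat.
Qed.

Lemma exists_overlap (I : eqType) (A : set S) (k : nat) :
  measurable A -> (0 < P A)%E -> exists N, forall (e : seq I) (Q : I -> set S),
  (N <= size e)%N -> (forall i, i \in e -> measurable (Q i) /\ P (Q i) = P A) ->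
  exists x, (k < count (fun i => x \in Q i) e)%N.
Proof.
move=> mA A0; have PA : P A = (fine (P A))%:E.
  by rewrite fineK// fin_num_measure.
have p0 : (0 < fine (P A))%R by rewrite -lte_fin -PA.
exists (Num.truncn (k%:R / fine (P A))%R).+1 => e Q Ne QA.
apply: contrapT => /forallNP noverlap.
have : (\sum_(i <- e) P (Q i) <= k%:R%:E)%E.
  apply: sum_measure_le_count => [i /QA[]//|x].
  by rewrite leqNgt; exact/negP/noverlap.
rewrite (eq_big_seq (fun=> (fine (P A))%:E)) => [|i /QA[_ ->]//].
rewrite sumEFin lee_fin big_const_seq count_predT iter_addr_0.
rewrite -[(_ *+ size e)%R]mulr_natl -ler_pdivlMr// leNgt => /negP; apply.
by apply: lt_le_trans (truncnS_gt _) _; rewrite ler_nat.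
Qed.

Lemma probability_bigcap_setC0 (U : nat -> set S) :
  (forall i, measurable (U i)) -> (forall i, P (~` U i) = 0%E) ->
  P (\bigcap_i U i) = 1%E.
Proof.
move=> mU U0; have mI : measurable (\bigcap_i U i) by exact: bigcapT_measurable.
rewrite -[X in P X]setCK probability_setC; last exact: measurableC.
suff -> : P (~` \bigcap_i U i) = 0%E by rewrite sube0.
have : P.-negligible (~` \bigcap_i U i).
  rewrite setC_bigcap; apply: negligible_bigcup => i.
  by exists (~` U i); split; [exact: measurableC|exact: U0|].
by move/measure_negligible; apply; exact: measurableC.
Qed.

End Probability.

Definition ginvariant_measure (T : choiceType) (G : permgroup T) (R : realType)
    (X : ptopologicalType) (act : (T -> T) -> X -> X)
    (mu : probability (borel X) R) :=
  forall g (A : set (borel X)), G g -> measurable A ->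
    mu (act g @^-1` A) = mu A.

Lemma open_borel (X : ptopologicalType) (U : set X) :
  open U -> measurable (U : set (borel X)).
Proof. by move=> oU; exact: sub_sigma_algebra. Qed.

Lemma closed_borel (X : ptopologicalType) (U : set X) :
  closed U -> measurable (U : set (borel X)).
Proof.
move=> cU; rewrite -[U]setCK; apply: measurableC; apply: open_borel.
exact: closed_openC.
Qed.

Section CylinderMeasures.
Variables (T : countType) (G : permgroup T) (M : ptopologicalType).
Variable R : realType.
Variables (act : (T -> T) -> M -> M) (lt : M -> rel T).
Hypothesis O : equivariant_order G act lt.
Implicit Types (m n : M) (l k s : seq T) (g h : T -> T).
Implicit Types (mu nu : probability (borel M) R).

Let lt_linear m : linear_order (lt m). Proof. exact: eorder_linear O m. Qed.

Lemma cyl_borel l : measurable (cyl lt l : set (borel M)).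
Proof. by apply: open_borel; exact: cyl_open O l. Qed.

Lemma measure_cyl_conjugate mu l k : ginvariant_measure G act mu ->
  conjugate G l k -> mu (cyl lt k) = mu (cyl lt l).
Proof.
move=> mu_inv [g Gg <-]; rewrite -(mu_inv g _ Gg (cyl_borel _)).
congr (mu _); apply/seteqP; split=> m;
  by rewrite /preimage /= -/(cyl lt _ _) (cyl_act O).
Qed.

Definition cells s : set (seq T) := [set l | l =i s /\ cyl lt l !=set0].

Lemma cells_uniq s l : cells s l -> uniq l.
Proof. by move=> [_ [m ml]]; exact: (linear_sorted_uniq (lt_linear m) ml). Qed.

Lemma cells_finite s : finite_set (cells s).
Proof.
apply: (@sub_finite_set _ _ [set` permutations (undup s)]); last first.
  exact: finite_seq.
move=> l sl /=; rewrite mem_permutations; apply: uniq_perm (undup_uniq s) _.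
  exact: cells_uniq sl.
by move=> a; rewrite mem_undup (proj1 sl).
Qed.

Definition ncells s : nat := size (finmap.enum_fset (fset_set (cells s))).

Lemma cells_trivIset s : trivIset (cells s) (cyl lt).
Proof.
move=> l k [ls _] [ks _] [m [ml mk]].
by apply: (linear_sorted_eq (lt_linear m) _ ml mk) => a; rewrite ls ks.
Qed.

Lemma cells_cover s m : exists2 l, cells s l & cyl lt l m.
Proof.
have [l sl ls] := exists_linear_sorted (lt_linear m) s.
by exists l => //; split=> //; exists m.
Qed.

Lemma measure_bigcup_cells mu s (D : set (seq T)) : D `<=` cells s ->
  mu (\bigcup_(l in D) cyl lt l) = (\sum_(l \in D) mu (cyl lt l))%E.
Proof.
move=> Ds; apply: measure_fin_bigcup => [||l _]; last exact: cyl_borel.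
  exact: sub_finite_set Ds (cells_finite s).
exact: sub_trivIset Ds (cells_trivIset (s := s)).
Qed.

Lemma measure_cell mu s l : ginvariant_measure G act mu -> cells s l ->
  (fine (mu (cyl lt l)) *+ ncells s = 1)%R.
Proof.
move=> mu_inv sl; apply: EFin_inj; rewrite -(probability_setT mu).
have -> : [set: borel M] = \bigcup_(k in cells s) cyl lt k.
  by apply/seteqP; split=> m // _; have [k] := cells_cover s m; exists k.
rewrite (measure_bigcup_cells _ (@subset_refl _ (cells s))).
rewrite (eq_fsbigr (fun=> (fine (mu (cyl lt l)))%:E)) => [|k].
  rewrite (fsbig_finite _ _ (cells_finite s)) /= sumEFin.
  by rewrite big_const_seq count_predT iter_addr_0.
rewrite inE => -[ks [n nk]]; have [ls [m ml]] := sl.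
rewrite (measure_cyl_conjugate (l := l) mu_inv) ?fineK ?fin_num_measure//.
  exact: cyl_borel.
by apply: (conjugate_cyl O _ ml nk) => a; rewrite ls ks.
Qed.

Lemma measure_cyl_gt0 mu l : ginvariant_measure G act mu -> cyl lt l !=set0 ->
  (0 < mu (cyl lt l))%E.
Proof.
move=> mu_inv l0; have sl : cells l l by [].
rewrite lt_neqAle measure_ge0 andbT eq_sym; apply/eqP => mul0.
by have /eqP := measure_cell mu_inv sl; rewrite mul0 mul0rn eq_sym oner_eq0.
Qed.

Lemma measure_cyl_unique mu nu l : ginvariant_measure G act mu ->
  ginvariant_measure G act nu -> mu (cyl lt l) = nu (cyl lt l).
Proof.
move=> mu_inv nu_inv; have [->|/set0P l0] := eqVneq (cyl lt l) set0.
  by rewrite !measure0.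
have sl : cells l l by [].
have fin (rho : probability (borel M) R) : rho (cyl lt l) \is a fin_num.
  by apply: fin_num_measure; exact: cyl_borel.
rewrite -(fineK (fin mu)) -(fineK (fin nu)); congr EFin.
apply: (@pmulrnI R (ncells l)).
  rewrite lt0n; apply/eqP => N0; have /eqP := measure_cell mu_inv sl.
  by rewrite N0 mulr0n eq_sym oner_eq0.
by rewrite (measure_cell mu_inv sl) (measure_cell nu_inv sl).
Qed.

Definition finitely_determined (A : set M) :=
  exists s, forall m, A m -> order_class lt s m `<=` A.

Lemma finitely_determined_cells (A : set M) : finitely_determined A ->
  exists s, A = \bigcup_(l in [set l | cells s l /\ cyl lt l `<=` A]) cyl lt l.
Proof.
move=> [s sA]; exists s; apply/seteqP; split=> m; last by move=> [l [_ lA] /lA].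
move=> Am; have [l sl ml] := cells_cover s m; exists l => //; split=> // n nl.
apply: (sA m Am) => a b; have [ls _] := sl; rewrite -!ls => al bl.
exact: sorted_agree (lt_linear n) (lt_linear m) nl ml a b al bl.
Qed.

Lemma measure_finitely_determined_unique mu nu (A : set M) :
  ginvariant_measure G act mu -> ginvariant_measure G act nu ->
  finitely_determined A -> mu (A : set (borel M)) = nu (A : set (borel M)).
Proof.
move=> mu_inv nu_inv /finitely_determined_cells[s ->].
rewrite !(@measure_bigcup_cells _ s); [|by move=> l []..].
by apply: eq_fsbigr => l _; exact: measure_cyl_unique.
Qed.

Lemma finitely_determined_setI : setI_closed finitely_determined.
Proof.
move=> A B [s sA] [t tB]; exists (s ++ t) => m [Am Bm] n nm.
split; [apply: (sA m Am)|apply: (tB m Bm)] => a b sa sb; apply: nm;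
  by rewrite mem_cat ?sa ?sb ?orbT.
Qed.

Lemma finitely_determined_open (A : set M) : finitely_determined A -> open A.
Proof.
move=> /finitely_determined_cells[s ->].
by apply: bigcup_open => l _; exact: cyl_open O l.
Qed.

Lemma cyl_finitely_determined l : finitely_determined (cyl lt l).
Proof. by exists l => m ml n nm; rewrite /cyl /= (agree_sorted nm). Qed.

Hypotheses (Mmin : gminimal G act) (ramseyG : ramsey_group G).

Lemma borel_finitely_determined :
  (measurable : set (set (borel M))) = <<s finitely_determined >>.
Proof.
apply/seteqP; split; apply: smallest_sub; try exact: smallest_sigma_algebra.
  move=> U oU; have -> : U = \bigcup_(l in [set l | cyl lt l `<=` U]) cyl lt l.
    apply/seteqP; split=> m; last by move=> [l lU /lU].
    move=> Um; have [l ml lU] := cyl_nbhs_base Mmin O ramseyG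
      (open_nbhs_nbhs (conj oU Um)).
    by exists l.
  rewrite bigcup_mkcond.
  apply: (@countable_bigcupT_measurable _
    (g_sigma_algebraType finitely_determined) (seq T)) => [|l].
    exact: countableP.
  case: ifP => _; last exact: measurable0.
  by apply: sub_sigma_algebra; exact: cyl_finitely_determined.
by move=> A /finitely_determined_open oA; exact: open_borel.
Qed.

Lemma ginvariant_measure_unique mu nu (A : set (borel M)) :
  ginvariant_measure G act mu -> ginvariant_measure G act nu ->
  measurable A -> mu A = nu A.
Proof.
move=> mu_inv nu_inv.
apply: (@measure_unique _ R (borel M) finitely_determined (fun=> setT)
  borel_finitely_determined) => //.
- exact: finitely_determined_setI.
- by move=> _; exists [::].
- by rewrite bigcup_const//; exists 0%N.
- by move=> B; exact: measure_finitely_determined_unique.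
- by move=> _; rewrite [ltLHS]probability_setT ltry.
Qed.

End CylinderMeasures.

(** * Orbits of positions are infinite *)

Lemma greedy_coloring (V : countType) (nb : V -> seq V) (N : nat) :
  (forall v, (size (nb v) <= N)%N) ->
  exists c : V -> 'I_N.+1, forall u v, u \in nb v -> v \in nb u -> u != v ->
    c u != c v.
Proof.
move=> nbN.
have free (s : seq 'I_N.+1) : (size s <= N)%N -> {x | x \notin s}.
  move=> sN; apply/sigW/existsP; apply: contraT => /existsPn all_s.
  have : (#|'I_N.+1| <= size s)%N.
    apply: leq_trans (card_size s); apply: subset_leq_card.
    by apply/fintype.subsetP => x _; have := all_s x; rewrite negbK.
  by rewrite card_ord ltnNge sN.
have nb_colors (c : V -> 'I_N.+1) v : (size (map c (nb v)) <= N)%N.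
  by rewrite size_map.
pose col := fix col n : V -> 'I_N.+1 := if n is n'.+1 then
  fun v => if pickle v == n' then sval (free _ (nb_colors (col n') v))
           else col n' v
  else fun=> ord0.
have colE n v : (pickle v < n)%N -> col n v = col (pickle v).+1 v.
  elim: n => // n IHn; rewrite ltnS leq_eqVlt => /predU1P[<-//|vn].
  by rewrite -(IHn vn) [LHS]/= (ltn_eqF vn).
have lt_neq u v : u \in nb v -> (pickle u < pickle v)%N ->
    col (pickle u).+1 u != col (pickle v).+1 v.
  move=> uv uv'; rewrite -(colE _ _ uv') [X in _ != X]/= eqxx.
  have := svalP (free _ (nb_colors (col (pickle v)) v)).
  by apply: contra => /eqP <-; exact: map_f.
exists (fun v => col (pickle v).+1 v) => u v uv vu uNv.
have := contra_neq (pcan_inj (@pickleK V) (x1 := u) (x2 := v)) uNv.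
by rewrite neq_ltn => /orP[] /lt_neq; [apply|rewrite eq_sym; apply].
Qed.

Section ConjugateColoring.
Variables (T : countType) (G : permgroup T).
Implicit Types (l k : seq T) (A B : seq (seq T)).

Lemma conjugate_neighbors l k A :
  (forall x, conjugate (fixator G l) k x -> x \in A) ->
  exists nb : seq T -> seq (seq T), (forall u, size (nb u) = size A) /\
    forall h, G h -> map h k \in nb (map h l).
Proof.
move=> kA.
have ex_frame u : exists g, conjugate G l u -> G g /\ map g l = u.
  by have [[g Gg gl]|nlu] := pselect (conjugate G l u); [exists g|exists id].
have [frame frameP] := choice ex_frame.
exists (fun u => map (map (frame u)) A).
split=> [u|h Gh]; first by rewrite size_map.
have [|Gg gl] := frameP (map h l); first by exists h.
set g := frame _ in Gg gl *; have GgV := permgroupV Gg.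
apply/mapP; exists (map (ginv g \o h) k); last first.
  by rewrite map_comp (map_ginvKV Gg).
apply: kA; exists (ginv g \o h) => //; split; first exact: permgroupM.
by move=> a al /=; have /eq_in_map/(_ a al) <- := gl; rewrite (ginvK Gg).
Qed.

Lemma conjugate_coloring l k A B : l != k ->
  (forall x, conjugate (fixator G l) k x -> x \in A) ->
  (forall x, conjugate (fixator G k) l x -> x \in B) ->
  exists N (c : seq T -> 'I_N), forall h, G h -> c (map h l) != c (map h k).
Proof.
move=> lk /conjugate_neighbors[nbA [sA nbAP]].
move=> /conjugate_neighbors[nbB [sB nbBP]].
have [u|c cP] := @greedy_coloring _ (fun u => nbA u ++ nbB u) (size A + size B).
  by rewrite size_cat sA sB.
exists (size A + size B).+1, c => h Gh; apply: cP.
- by rewrite mem_cat nbBP ?orbT.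
- by rewrite mem_cat nbAP.
- by rewrite (inj_eq (inj_map (permgroup_inj Gh))).
Qed.

End ConjugateColoring.

Section RamseyIncreasing.
Variables (T : countType) (G : permgroup T) (M : topologicalType).
Variables (act : (T -> T) -> M -> M) (lt : M -> rel T).
Hypotheses (O : equivariant_order G act lt) (ramseyG : ramsey_group G).
Implicit Types (m : M) (l k t x : seq T) (A B : seq (seq T)).

Let lt_linear m : linear_order (lt m). Proof. exact: eorder_linear O m. Qed.

Lemma ramsey_increasing (K : finType) (c : seq T -> K) m l t : cyl lt t m ->
  exists2 h, G h & exists i, forall x, conjugate G l x -> subseq x t ->
    c (map h x) = i.
Proof.
move=> mt.
pose chi (S : set T) := c (xget [::] [set w | cyl lt w m /\ [set` w] = S]).
have chiE w : cyl lt w m -> chi [set` w] = c w.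
  move=> mw; congr c; apply: xget_unique => [|w' [mw' w'w]]; first by [].
  by apply: (linear_sorted_eq (lt_linear m) _ mw' mw); exact: set_seq_eq_mem.
have [C CP] := ramseyG K l t; have [h0 [Gh0 _ [i iP]]] := CP chi.
have [w mw wt] := exists_linear_sorted (lt_linear m) (map h0 t).
have [g Gg gt] : conjugate G t w.
  apply: (@conjugate_trans _ _ (map h0 t)); first by exists h0.
  by apply: (conjugate_cyl O _ (m := act h0 m) _ mw); rewrite ?(cyl_act O).
exists g => //; exists i => x [f Gf <-] xt; rewrite -map_comp.
rewrite -(iP _ (permgroupM Gg Gf)) => [|a].
  rewrite chiE // map_comp; apply: (cyl_subseq O _ mw).
  by rewrite -gt; exact: map_subseq.
rewrite -wt -gt map_comp; exact/mem_subseq/map_subseq.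
Qed.

Lemma conjugates_not_both_covered m l k t A B : cyl lt t m ->
  subseq l t -> subseq k t -> conjugate G l k -> l != k ->
  (forall x, conjugate (fixator G l) k x -> x \in A) ->
  ~ (forall x, conjugate (fixator G k) l x -> x \in B).
Proof.
move=> mt l_t k_t lk neq kA lB.
have [N [c cP]] := conjugate_coloring neq kA lB.
have [h Gh [i iP]] := ramsey_increasing c l mt.
have /negP := cP h Gh; apply; apply/eqP.
by rewrite !iP//; exact: conjugate_refl.
Qed.

End RamseyIncreasing.

(** * Unrealised positions are negligible *)

Lemma exists_blocks (T : eqType) (d N : nat) (e : seq T) :
  (N * d <= size e)%N ->
  exists bs : seq (seq T), [/\ size bs = N,
    forall x, x \in bs -> size x = d /\ subseq x e
    & pairwise (fun x y => subseq (x ++ y) e) bs].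
Proof.
elim: N e => [|N IHN] e; first by exists [::].
rewrite mulSn => Ne; have [|bs [bsN bsP pbs]] := IHN (drop d e).
  by rewrite size_drop leq_subRL// (leq_trans _ Ne)// leq_addr.
exists (take d e :: bs); split=> [|x|] /=; first by rewrite bsN.
  rewrite inE => /predU1P[->|/bsP[xd xe]].
    by rewrite take_subseq size_takel// (leq_trans _ Ne)// leq_addr.
  by split=> //; exact: subseq_trans xe (drop_subseq _ _).
apply/andP; split.
  apply/allP => x /bsP[_ xe]; rewrite -{2}(cat_take_drop d e).
  by rewrite cat_subseq.
by apply: sub_pairwise pbs => x y xy; exact: subseq_trans xy (drop_subseq _ _).
Qed.

Lemma count_pairwise (T : eqType) (r : rel T) (a : pred T) (s : seq T) :
  pairwise r s -> (1 < count a s)%N ->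
  exists x y, [/\ x \in s, y \in s, a x, a y & r x y].
Proof.
rewrite -size_filter => prs; have := subseq_pairwise (filter_subseq a s) prs.
have in_s x : x \in [seq x <- s | a x] -> x \in s /\ a x.
  by rewrite mem_filter => /andP[].
case: [seq x <- s | a x] in_s => [|x [|y w]]//= in_s /andP[/andP[xy _] _] _.
have [xs ax] := in_s x (mem_head _ _).
have [ys ay] : y \in s /\ a y by apply: in_s; rewrite !inE eqxx orbT.
by exists x, y.
Qed.

Section Position.
Variables (T : countType) (G : permgroup T) (M : ptopologicalType).
Variable R : realType.
Variables (act : (T -> T) -> M -> M) (lt : M -> rel T).
Hypotheses (Mmin : gminimal G act) (O : equivariant_order G act lt).
Hypothesis ramseyG : ramsey_group G.
Variable mu : probability (borel M) R.
Hypothesis mu_inv : ginvariant_measure G act mu.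
Implicit Types (m n : M) (a v : T) (e l k w x y : seq T) (f g h : T -> T).

Let lt_linear m : linear_order (lt m). Proof. exact: eorder_linear O m. Qed.

Variables (low s high : seq T) (b : T) (m1 m2 : M).
Hypotheses (s_neq0 : s != [::]) (m1P : cyl lt (low ++ b :: s ++ high) m1)
  (m2P : cyl lt (low ++ s ++ b :: high) m2).

Let H := fixator G (low ++ high).

(* By homogeneity, [x] realises the type of [b :: s] over [low ++ high]. *)
Definition realizes x := conjugate H (b :: s) x.

Lemma conjugate_between m n x y : perm_eq x y ->
  cyl lt (low ++ x ++ high) m -> cyl lt (low ++ y ++ high) n -> conjugate H x y.
Proof.
move=> xy mx ny; apply/conjugate_fixatorP; first exact: perm_size.
apply: (conjugate_cyl O _ mx ny); apply: perm_mem.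
by rewrite perm_cat2l perm_cat2r.
Qed.

Lemma realizes_trans x y : realizes x -> conjugate H x y -> realizes y.
Proof. exact: conjugate_trans. Qed.

Lemma realizes_rot1 x : realizes x -> realizes (rot 1 x).
Proof.
move=> bx; apply: realizes_trans (conjugate_rot 1 bx); rewrite rot1_cons.
apply: (@conjugate_between m1 m2 (b :: s)) => //; last by rewrite cat_rcons.
by rewrite perm_sym perm_rcons.
Qed.

Lemma realizes_rcons v : realizes (rcons s v) <-> realizes (v :: s).
Proof.
split=> [|/realizes_rot1]; last by rewrite rot1_cons.
have /conjugate_sym := realizes_rot1 (conjugate_refl H (b :: s)).
rewrite rot1_cons => sb /(conjugate_trans sb)/(conjugate_rot (size s)).
by rewrite -!cats1 !rot_size_cat.
Qed.

(* A conjugate of [s'] over [s], or of [s] over [s'], is determined by the image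
   of one point, which [e] would confine to a finite set. *)
Lemma realizes_not_covered e : ~ (forall v, realizes (v :: s) -> v \in e).
Proof.
move=> eP; have [r rH rbs] : conjugate H (b :: s) (rcons s b).
  by have := realizes_rot1 (conjugate_refl _ _); rewrite rot1_cons.
pose s' := belast b s; pose z := last b s.
have /rcons_inj[rs' _] : rcons (map r s') (r z) = rcons s b.
  by rewrite -map_rcons -lastI.
have H_context f l : fixator G l f -> {subset low ++ high <= l} -> H f.
  by move=> [Gf fl] sub; split=> // a /sub/fl.
have sub_context w : {subset low ++ high <= low ++ w ++ high}.
  by move=> a; rewrite !mem_cat => /orP[] ->; rewrite ?orbT.
apply: (@conjugates_not_both_covered _ _ _ _ _ O ramseyG m1 (low ++ s ++ high)
  (low ++ s' ++ high) _ [seq low ++ belast v s ++ high | v <- e]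
  [seq low ++ behead (rcons s' (ginv r v)) ++ high | v <- e] m1P).
- by apply: cat_subseq => //; exact: subseq_cons.
- apply: cat_subseq => //; rewrite -cat_cons lastI -/s' cat_rcons.
  by apply: cat_subseq => //; exact: subseq_cons.
- apply: conjugate_sym; exists r; first by case: rH.
  by rewrite (map_fixator_cat _ rH) rs'.
- apply: contraNneq (linear_sorted_notin (lt_linear m1) m1P) => ->.
  rewrite !mem_cat; apply/orP; right.
  by rewrite /s'; move: s_neq0; case: (s) => //= a t; rewrite mem_head.
- move=> _ [f fl <-]; have fH := H_context _ _ fl (sub_context _).
  have fs : map f s = s.
    by apply: (map_fixator fl) => a; rewrite !mem_cat => ->; rewrite orbT.
  rewrite (map_fixator_cat _ fH) -belast_map fs; apply/map_f/eP.
  by exists f => //=; rewrite fs.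
- move=> _ [f fk <-]; have fH := H_context _ _ fk (sub_context _).
  have fs' : map f s' = s'.
    by apply: (map_fixator fk) => a; rewrite !mem_cat => ->; rewrite orbT.
  rewrite (map_fixator_cat _ fH).
  have -> : map f s = behead (rcons s' (ginv r (r (f z)))).
    by rewrite (ginvK (proj1 rH)) -{1}fs' -map_rcons -lastI.
  apply/mapP; exists (r (f z)) => //; apply: eP.
  apply/realizes_rcons; apply: (@realizes_trans (rcons s' (f z))).
    by exists f; rewrite // lastI map_rcons fs'.
  by exists r; rewrite // map_rcons rs'.
Qed.

Lemma realizes_infinite N :
  exists e, [/\ uniq e, size e = N & forall v, v \in e -> realizes (v :: s)].
Proof.
elim: N => [|N [e [ue eN eP]]]; first by exists [::].
have [v [vP ve]] : exists v, realizes (v :: s) /\ v \notin e.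
  apply: contrapT => /forallNP nv; apply: (@realizes_not_covered e) => v vP.
  by apply/negPn/negP => ve; apply: (nv v).
exists (v :: e); split; rewrite /= ?ve ?eN// => y.
by rewrite inE => /predU1P[->|/eP].
Qed.

Let missing : set M := ~` extends G lt low b (s ++ high).

Lemma missing_context m : missing m -> cyl lt (low ++ s ++ high) m.
Proof. by move=> /not_implyP[]. Qed.

Lemma missing_not_realized m v : missing m -> realizes (v :: s) ->
  ~ cyl lt (low ++ v :: s ++ high) m.
Proof.
move=> /not_implyP[_ /not_implyP[_ mP]] vP mv; apply: mP; exists v => //.
exact/(conjugate_fixatorP G low high (x := b :: s) (y := v :: s)).
Qed.

Lemma missing_closed : closed missing.
Proof. by apply: open_closedC; exact: extends_open O _ _ _. Qed.

Lemma cyl_fixator_act g m x : H g ->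
  cyl lt (low ++ map g x ++ high) (act g m) = cyl lt (low ++ x ++ high) m.
Proof.
by move=> gH; rewrite -(map_fixator_cat _ gH) (cyl_act O)//; case: gH.
Qed.

Lemma missing_lt m v w v' w' g g' : v != v' ->
  H g -> map g (v :: w) = s -> H g' -> map g' (v' :: w') = s ->
  realizes (rcons (v :: w) v') ->
  missing (act g m) -> missing (act g' m) -> lt m v v'.
Proof.
move=> vv' gH gs g'H g's vP gm g'm.
have vm : cyl lt (low ++ v :: w ++ high) m.
  by have := missing_context gm; rewrite -gs cyl_fixator_act.
have v'm : cyl lt (low ++ v' :: w' ++ high) m.
  by have := missing_context g'm; rewrite -g's cyl_fixator_act.
have := linear_total (lt_linear m) vv'; case: (lt m v v') => //= v'v.
case: (missing_not_realized gm (v := g v')).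
  apply/realizes_rcons/(realizes_trans vP).
  by exists g; rewrite // map_rcons gs.
have := cyl_fixator_act m [:: v', v & w] gH; rewrite map_cons gs => ->.
move: vm v'm; rewrite /cyl /= !sorted_cat_cons => /andP[_ vwh] /andP[lv' _].
by rewrite lv' /= v'v.
Qed.

Lemma missing_disjoint m v w v' w' g g' : v != v' ->
  H g -> map g (v :: w) = s -> H g' -> map g' (v' :: w') = s ->
  realizes (rcons (v :: w) v') -> realizes (rcons (v' :: w') v) ->
  missing (act g m) -> ~ missing (act g' m).
Proof.
move=> vv' gH gs g'H g's vP v'P gm g'm.
have vv'm := missing_lt vv' gH gs g'H g's vP gm g'm.
have /negP := linear_asym (lt_linear m) vv'm; apply.
by apply: (missing_lt _ g'H g's gH gs v'P g'm gm); rewrite eq_sym.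
Qed.

Definition straddling m n e := sorted (lt m) e /\ forall v, v \in e ->
  [/\ realizes (v :: s), cyl lt (low ++ v :: s ++ high) m
    & cyl lt (low ++ s ++ v :: high) n].

Lemma measure_realizes v : realizes (v :: s) ->
  mu (cyl lt (low ++ v :: s ++ high)) = mu (cyl lt (low ++ b :: s ++ high)) /\
  mu (cyl lt (low ++ s ++ v :: high)) = mu (cyl lt (low ++ s ++ b :: high)).
Proof.
move=> vP; split; apply: (measure_cyl_conjugate O mu_inv).
  exact/(conjugate_fixatorP G low high (x := b :: s) (y := v :: s)).
rewrite -!cat_rcons; apply/conjugate_fixatorP; rewrite ?size_rcons//.
apply: conjugate_trans (iffRL (realizes_rcons v) vP); apply: conjugate_sym.
exact/realizes_rcons/conjugate_refl.
Qed.

Lemma exists_straddling (k : nat) :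
  exists m n e, straddling m n e /\ (k <= size e)%N.
Proof.
pose below v : set (borel M) := cyl lt (low ++ v :: s ++ high).
pose above v : set (borel M) := cyl lt (low ++ s ++ v :: high).
have mbelow v : measurable (below v) by exact: cyl_borel O _.
have mabove v : measurable (above v) by exact: cyl_borel O _.
have [||N2 N2P] := @exists_overlap _ _ _ mu T (above b) k => //.
  by apply: (measure_cyl_gt0 O mu_inv); exists m2.
have [||N1 N1P] := @exists_overlap _ _ _ mu T (below b) N2 => //.
  by apply: (measure_cyl_gt0 O mu_inv); exists m1.
have [e0 [ue0 se0 e0P]] := realizes_infinite N1.
have [||m me] := N1P e0 below; first by rewrite se0.
  by move=> v /e0P/measure_realizes[].
pose e1 := [seq v <- e0 | m \in below v].
have [||n ne] := N2P e1 above; first by rewrite size_filter ltnW.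
  by move=> v; rewrite mem_filter => /andP[_ /e0P/measure_realizes[]].
pose e2 := [seq v <- e1 | n \in above v].
have [e se ee2] := exists_linear_sorted (lt_linear m) e2.
have ue2 : uniq e2 by do 2![apply: filter_uniq].
exists m, n, e; split; last first.
  rewrite (perm_size (uniq_perm (linear_sorted_uniq (lt_linear m) se) ue2 ee2)).
  by rewrite size_filter ltnW.
split=> // v; rewrite ee2 !mem_filter.
by move=> /and3P[/set_mem nv /set_mem mv /e0P vP]; split.
Qed.

Section Straddling.
Variables (m n : M) (e : seq T).
Hypothesis e_straddling : straddling m n e.

(* The order of [m] puts the block below [s], that of [n] puts it above [s]. *)
Lemma straddling_block x : (0 < size x)%N -> subseq x e ->
  exists2 y, perm_eq x y & conjugate H (x ++ s) (s ++ y).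
Proof.
move=> x0 xe; have [se eP] := e_straddling; have sub := mem_subseq xe.
have [v ve] : exists v, v \in e.
  by exists (nth b x 0%N); apply/sub/mem_nth.
have [_ vm vn] := eP v ve.
have m_context : cyl lt (low ++ s ++ high) m.
  by apply: (cyl_subseq O _ vm); rewrite cat_subseq// subseq_cons.
have n_context : cyl lt ((low ++ s) ++ high) n.
  by apply: (cyl_subseq O _ vn); rewrite catA cat_subseq// subseq_cons.
have sx := subseq_sorted (@linear_trans _ _ (lt_linear m)) xe se.
have [y ny yx] := exists_linear_sorted (lt_linear n) x.
have ux := linear_sorted_uniq (lt_linear m) sx.
have uy := linear_sorted_uniq (lt_linear n) ny.
have xy : perm_eq x y by rewrite perm_sym uniq_perm.
exists y => //; apply: (@conjugate_between m n).
- by rewrite perm_catC perm_cat2l.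
- rewrite -catA; apply: (linear_sorted_between (lt_linear m)) => // a.
  by move=> /sub/eP[_ am _]; exact: am.
- rewrite -catA catA; apply: (linear_sorted_between (lt_linear n)) => // a.
  by rewrite yx -catA => /sub/eP[].
Qed.

Lemma straddling_conjugate x : size x = size s -> subseq x e -> conjugate H x s.
Proof.
move=> xs xe; have [|y _] := straddling_block _ xe.
  by rewrite xs lt0n size_eq0.
exact: conjugate_catl.
Qed.

Lemma straddling_realizes w v : size w = size s -> subseq (rcons w v) e ->
  realizes (rcons w v).
Proof.
move=> ws wve; have [|[|v' y] xy] := straddling_block _ wve.
- by rewrite size_rcons.
- by move: (perm_size xy); rewrite size_rcons.
rewrite -cat_rcons => /conjugate_catl; rewrite !size_rcons ws => /(_ erefl) wv.
apply: (@realizes_trans (rcons s v')); last exact: conjugate_sym.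
apply/realizes_rcons; have [_ /(_ v')[]//] := e_straddling.
apply: (mem_subseq wve).
by rewrite (perm_mem xy) mem_head.
Qed.

Lemma straddling_blocks_disjoint x y g g' p :
  size x = size s -> size y = size s ->
  subseq (x ++ y) e -> H g -> map g x = s -> H g' -> map g' y = s ->
  missing (act g p) -> ~ missing (act g' p).
Proof.
case: x => [|v w]; first by move: s_neq0; case: (s).
case: y => [|v' w']; first by move: s_neq0; case: (s).
move=> ws w's xye gH gs g'H g's; have [se _] := e_straddling.
apply: (missing_disjoint _ gH gs g'H g's).
- have sxy := subseq_sorted (@linear_trans _ _ (lt_linear m)) xye se.
  have := linear_sorted_uniq (lt_linear m) sxy.
  by rewrite /= mem_cat inE negb_or => /andP[/andP[_ /norP[]]].
- apply: straddling_realizes => //; apply: subseq_trans xye.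
  by rewrite -cats1 cat_subseq// sub1seq mem_head.
- rewrite -rot1_cons; apply: realizes_rot1.
  rewrite lastI; apply: straddling_realizes; first by rewrite size_belast.
  rewrite -lastI; apply: subseq_trans xye.
  by rewrite /= eqxx suffix_subseq.
Qed.

End Straddling.

Lemma missing_null : mu (missing : set (borel M)) = 0%E.
Proof.
apply/eqP; apply: contraT => mu0.
have [||N NP] := @exists_overlap _ _ _ mu (seq T) missing 1.
- by apply: closed_borel; exact: missing_closed.
- by rewrite lt_neqAle eq_sym mu0 measure_ge0.
have [m [n [e [e_straddling Ne]]]] := exists_straddling (N * size s).
have [bs [bsN bsP bs_pw]] := exists_blocks Ne.
have ex_move x : exists g, x \in bs -> H g /\ map g x = s.
  have [xbs|_] := boolP (x \in bs); last by exists id.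
  have [xs xe] := bsP x xbs.
  by have [g gH gx] := straddling_conjugate e_straddling xs xe; exists g.
have [g gP] := choice ex_move.
have [||p] := NP bs (fun x => act (g x) @^-1` missing).
- by rewrite bsN.
- move=> x /gP[[Gg _] _]; split; last first.
    exact: (mu_inv Gg (closed_borel missing_closed)).
  apply: closed_borel; apply: preimage_closed; last exact: missing_closed.
  by move=> q _; exact: (gflow_continuous (gminimal_flow Mmin)).
move=> /(count_pairwise bs_pw)[x [y [xbs ybs /set_mem xp /set_mem yp xye]]].
have [[xs _] [ys _]] := (bsP x xbs, bsP y ybs).
have [[gxH gxs] [gyH gys]] := (gP x xbs, gP y ybs).
have := straddling_blocks_disjoint e_straddling xs ys xye gxH gxs gyH gys xp.
exact.
Qed.

End Position.

Lemma cat_eq_cat (T : Type) (l1 l2 k1 k2 : seq T) :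
  l1 ++ l2 = k1 ++ k2 -> (size l1 <= size k1)%N ->
  exists2 s, k1 = l1 ++ s & l2 = s ++ k2.
Proof.
elim: l1 k1 => [|a l1 IHl1] [|b k1] //=; [by exists [::]|by exists (b :: k1)|].
by move=> [-> lk] lk1; have [s -> ->] := IHl1 _ lk lk1; exists s.
Qed.

Section FullMeasure.
Variables (T : countType) (G : permgroup T) (M : ptopologicalType).
Variable R : realType.
Variables (act : (T -> T) -> M -> M) (mu : probability (borel M) R).
Hypotheses (Mmin : gminimal G act) (ramseyG : ramsey_group G).
Hypothesis mu_inv : ginvariant_measure G act mu.
Implicit Types (lt : M -> rel T) (l : seq T) (b : T).

Lemma cyl_rev lt l : cyl (fun m a b => lt m b a) (rev l) = cyl lt l.
Proof. by apply/seteqP; split=> m; rewrite /cyl /= rev_sorted. Qed.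

Lemma extends_rev lt l1 b l2 :
  extends G (fun m a b => lt m b a) (rev l2) b (rev l1) = extends G lt l1 b l2.
Proof.
have revE v : rev l2 ++ v :: rev l1 = rev (l1 ++ v :: l2).
  by rewrite rev_cat rev_cons cat_rcons.
have conjE v : conjugate G (rev l2 ++ b :: rev l1) (rev l2 ++ v :: rev l1) <->
    conjugate G (l1 ++ b :: l2) (l1 ++ v :: l2).
  by rewrite !revE; split=> /conjugate_rev; rewrite ?revK.
have cylE v : cyl (fun m a b => lt m b a) (rev l2 ++ v :: rev l1) =
    cyl lt (l1 ++ v :: l2) by rewrite revE cyl_rev.
apply/seteqP; split=> m;
  rewrite /extends /mkset -rev_cat cyl_rev cylE => mP ml ne;
  have [v /conjE bv vm] := mP ml ne; exists v => //.
- by rewrite -cylE.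
- by rewrite cylE.
Qed.

Lemma extends_null lt l1 b l2 : equivariant_order G act lt ->
  mu (~` extends G lt l1 b l2 : set (borel M)) = 0%E.
Proof.
move=> O; have setT_null : extends G lt l1 b l2 = setT ->
    mu (~` extends G lt l1 b l2 : set (borel M)) = 0%E.
  by move=> ->; rewrite setCT measure0.
have [[m1 m1P]|ne] := pselect (cyl lt (l1 ++ b :: l2) !=set0); last first.
  by apply: setT_null; apply/seteqP; split=> m // _ _ /ne.
have [all|/existsNP[m2 /not_implyP[m2l m2b]]] :=
    pselect (forall m, cyl lt (l1 ++ l2) m -> cyl lt (l1 ++ b :: l2) m).
  apply: setT_null; apply/seteqP; split=> m // _ ml _.
  by exists b; [exact: conjugate_refl|exact: all].
have bl := linear_sorted_notin (eorder_linear O m1) m1P.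
have [k1 [k2 [lk m2k]]] := linear_sorted_insert (eorder_linear O m2) bl m2l.
have [lt12|/ltnW le21] := leqP (size l1) (size k1).
  have [s k1E l2E] := cat_eq_cat lk lt12.
  rewrite l2E.
  apply: (missing_null Mmin O ramseyG mu_inv (m1 := m1) (m2 := m2)).
  - by apply: contra_notN m2b => /eqP s0; move: m2k; rewrite k1E l2E s0 cats0.
  - by rewrite -l2E.
  - by rewrite catA -k1E.
have [s l1E k2E] := cat_eq_cat (esym lk) le21.
rewrite -extends_rev l1E rev_cat.
apply: (missing_null Mmin (equivariant_order_rev O) ramseyG mu_inv
  (m1 := m1) (m2 := m2)).
- apply: contra_notN m2b; rewrite -size_eq0 size_rev size_eq0 => /eqP s0.
  by move: m2k; rewrite k2E l1E s0 cats0.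
- have -> : rev l2 ++ b :: rev s ++ rev k1 = rev (l1 ++ b :: l2).
    by rewrite l1E !rev_cat rev_cons cat_rcons.
  by rewrite cyl_rev.
- have -> : rev l2 ++ rev s ++ b :: rev k1 = rev (k1 ++ b :: k2).
    by rewrite k2E rev_cat rev_cons rev_cat cat_rcons -!catA.
  by rewrite cyl_rev.
Qed.

Lemma generic_full lt : equivariant_order G act lt ->
  mu (generic G lt : set (borel M)) = 1%E.
Proof.
move=> O; rewrite generic_bigcap; apply: probability_bigcap_setC0 => i.
  apply: open_borel; case: unpickle => [[[l1 b] l2]|]; last exact: openT.
  exact: extends_open O _ _ _.
case: unpickle => [[[l1 b] l2]|]; first exact: extends_null.
by rewrite setCT measure0.
Qed.

End FullMeasure.

(** * The generic orbit carries the measure *)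

Section GenericOrbit.
Variables (T : countType) (G : permgroup T) (M : ptopologicalType).
Variable R : realType.
Variables (act : (T -> T) -> M -> M) (lt : M -> rel T).
Variable mu : probability (borel M) R.
Hypotheses (Mmin : gminimal G act) (O : equivariant_order G act lt).
Hypotheses (ramseyG : ramsey_group G) (Gclosed : closed_permgroup G).
Hypothesis mu_inv : ginvariant_measure G act mu.

Lemma exists_gorbit_generic : exists x, gorbit G act x = generic G lt.
Proof.
have [x gx] : generic G lt !=set0.
  apply/set0P/eqP => g0; have := generic_full Mmin ramseyG mu_inv O.
  by rewrite g0 measure0 => /eqP; rewrite eq_sym onee_eq0.
exists x; apply/seteqP; split=> [_ [g Gg ->]|y gy].
  exact: (generic_inv O).
exact: (generic_sub_gorbit Mmin O ramseyG Gclosed).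
Qed.

Lemma ginvariant_measure_concentrated : exists x,
  [/\ dense (gorbit G act x), G_delta (gorbit G act x),
      mu (gorbit G act x) = 1%E
    & forall y, dense (gorbit G act y) -> G_delta (gorbit G act y) ->
        gorbit G act y = gorbit G act x].
Proof.
have [x xE] := exists_gorbit_generic.
have dense_x := gminimal_dense_orbit Mmin x.
have G_delta_x : G_delta (gorbit G act x).
  by rewrite xE; exact: generic_G_delta O.
exists x; split=> // [|y].
  by rewrite xE; exact: (generic_full Mmin ramseyG mu_inv O).
exact: (dense_G_delta_gorbit_unique (gminimal_flow Mmin)).
Qed.

End GenericOrbit.

(** * Automorphism groups of Fraisse limits *)

Lemma inj_surj_bij (A B : Type) (f : A -> B) :
  injective f -> (forall b, exists a, f a = b) -> bijective f.
Proof.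
move=> f_inj f_surj; have [h hP] := choice f_surj.
by exists h => // a; apply: f_inj; rewrite hP.
Qed.

Lemma inj_pcancel (A B : Type) (f : A -> B) : injective f ->
  exists g, pcancel f g.
Proof.
move=> f_inj; have ex_g b : exists o, forall a, f a = b -> o = Some a.
  have [[a <-]|nb] := pselect (exists a, f a = b).
    by exists (Some a) => a' /f_inj ->.
  by exists None => a fa; case: nb; exists a.
by have [g gP] := choice ex_g; exists g => a; exact: gP.
Qed.

Lemma List_InP (T : eqType) (x : T) (s : seq T) : List.In x s <-> x \in s.
Proof.
elim: s => [|a s IHs] //=; rewrite inE.
split=> [[->|/IHs ->]|/predU1P[->|/IHs]].
- by rewrite eqxx.
- by rewrite orbT.
- by left.
- by right.
Qed.

Section Structures.
Variable L : language.
Implicit Types A B C : structure L.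

Lemma isomorphism_comp A B C (f : A -> B) (g : B -> C) :
  isomorphism f -> isomorphism g -> isomorphism (g \o f).
Proof.
move=> [[f_inj f_rel] f_bij] [[g_inj g_rel] g_bij]; split; last exact: bij_comp.
by split=> [|r t]; [exact: inj_comp|rewrite f_rel g_rel].
Qed.

Lemma isomorphism_can A B (f : A -> B) : isomorphism f ->
  exists2 g : B -> A, isomorphism g & cancel f g /\ cancel g f.
Proof.
move=> [[f_inj f_rel] [g fg gf]]; exists g => //; split; last by exists f.
split=> [|r t]; first exact: can_inj gf.
rewrite f_rel; suff -> : f \o (g \o t) = t by [].
by apply/funext => i /=; rewrite gf.
Qed.

Lemma isomorphic_trans B A C : isomorphic A B -> isomorphic B C ->
  isomorphic A C.
Proof.
by move=> [f f_iso] [g g_iso]; exists (g \o f); exact: isomorphism_comp.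
Qed.

Lemma isomorphic_sym A B : isomorphic A B -> isomorphic B A.
Proof. by move=> [f /isomorphism_can[g g_iso _]]; exists g. Qed.

Lemma induced_inj C (S : set C) (x y : Defs.induced S) :
  sval x = sval y -> x = y.
Proof.
by apply: eq_sig_hprop => a p q; exact: Prop_irrelevance.
Qed.

Lemma induced_embedding C (S : set C) : embedding (sval : Defs.induced S -> C).
Proof. by split=> // x y; exact: induced_inj. Qed.

Lemma isomorphic_induced_image A B (f : A -> B) (S : set A) : embedding f ->
  isomorphic (Defs.induced S) (Defs.induced (f @` S)).
Proof.
move=> [f_inj f_rel].
pose F (x : Defs.induced S) : Defs.induced (f @` S) :=
  exist _ (f (sval x)) (ex_intro2 _ _ (sval x) (svalP x) erefl).
exists F; split.
  by split=> [x y [] /f_inj/induced_inj|r t] //=; rewrite f_rel.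
apply: inj_surj_bij => [x y [] /f_inj/induced_inj //|[y [x Sx fx]]].
by exists (exist _ x Sx); exact: induced_inj.
Qed.

Lemma copies_imageP A B C (f : B -> C) (S : set B) : embedding f ->
  copies C A (f @` S) <-> copies B A S.
Proof.
move=> /(isomorphic_induced_image S) SfS.
split; last by move/isomorphic_trans; apply.
by move/isomorphic_trans; apply; exact: isomorphic_sym.
Qed.

Lemma ultrahomogeneous_copy C (S1 S2 : set C) : ultrahomogeneous C ->
  finite_structure (Defs.induced S1) -> copies C (Defs.induced S1) S2 ->
  exists2 g : C -> C, automorphism g & g @` S1 = S2.
Proof.
move=> C_hom S1_fin [p p_iso]; have [g [g_aut gp]] := C_hom _ _ _ S1_fin p_iso.
exists g => //; have [_ [p' _ pK]] := p_iso; apply/seteqP; split=> y.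
  by move=> [x S1x <-]; rewrite (gp (exist _ x S1x)); exact: svalP.
move=> S2y; pose x := p' (exist _ y S2y); exists (sval x); first exact: svalP x.
by rewrite gp pK.
Qed.

End Structures.

Section AutomorphismGroup.
Variables (L : language) (F : structure L).

Lemma automorphism1 : automorphism (id : F -> F).
Proof. by split; [split|exists id]. Qed.

Lemma automorphismM (g h : F -> F) :
  automorphism g -> automorphism h -> automorphism (g \o h).
Proof. by move=> g_aut h_aut; exact: isomorphism_comp. Qed.

Definition aut_group : permgroup F :=
  PermGroup automorphism1 automorphismM (@isomorphism_can L F F).

Variables (pk : F -> nat) (unpk : nat -> option F) (pkK : pcancel pk unpk).
Local Notation T := (pcan_type pkK).
Local Notation G := (aut_group : permgroup T).

Lemma aut_group_closed : closed_permgroup G.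
Proof.
move=> f f_bij fP; split=> //; split=> [|r t]; first exact: bij_inj.
have [h [[_ h_rel] _] hf] := fP [seq (t i : T) | i <- enum 'I_(arity r)].
rewrite h_rel; suff -> : h \o t = f \o t by [].
by apply/funext => i /=; apply: hf; apply/mapP; exists i; rewrite ?mem_enum.
Qed.

Lemma minimal_flowP (X : topologicalType) (act : (F -> F) -> X -> X) :
  minimal_flow act <-> gminimal G act.
Proof.
have flowP : flow act <-> gflow G act.
  split=> -[Xc Xh act1 actM cont]; split=> // g x U Gg nU;
    have [s [V [nV VP]]] := cont g x U Gg nU;
    exists s, V; split=> // h y Gh hs Vy;
    by apply: VP => // z /(@List_InP T); exact: hs.
by split=> -[/flowP ? ? ?].
Qed.

Lemma induced_seq_finite (s : seq T) :
  finite_structure (Defs.induced ([set` s] : set F)).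
Proof.
pose u := undup s.
have us (i : 'I_(size u)) : tnth (in_tuple u) i \in s.
  by rewrite -mem_undup; exact: mem_tnth.
exists (size u), (fun i => exist (fun x => is_true (x \in s)) _ (us i)).
apply: inj_surj_bij => [i j [] ij|[x xs]].
  by apply: (tuple_uniqP (in_tuple u) _ _ _ ij); exact: undup_uniq.
have xu : (x : T) \in u by rewrite mem_undup.
have /tnthP[i xi] : (x : T) \in in_tuple u := xu.
by exists i; apply: induced_inj; rewrite /= -xi.
Qed.

Variable K : structure L -> Prop.
Hypotheses (Kfin : class_of_finite K) (Kramsey : ramsey_class K).
Hypotheses (Fage : age_is F K) (Fhom : ultrahomogeneous F).

Lemma induced_seq_age (s : seq T) : K (Defs.induced ([set` s] : set F)).
Proof.
apply/(Fage (induced_seq_finite s)).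
by exists sval; exact: induced_embedding.
Qed.

Lemma aut_group_ramsey : ramsey_group G.
Proof.
move=> Q s t; have t_fin := induced_seq_finite t.
have [C [KC CP]] := Kramsey (induced_seq_age s) (induced_seq_age t)
  (isT : 2 <= #|Q|.+2)%N.
have C_fin := Kfin.1 _ KC; have [f f_emb] := (Fage C_fin).1 KC.
have [f_inj _] := f_emb; have [n [e [e' _ eK]]] := C_fin.
exists [seq (f (e i) : T) | i <- enum 'I_n] => chi.
pose code (q : Q) := lift ord0 (lift ord0 (enum_rank q)).
have code_inj : injective code by move=> q q' /lift_inj/lift_inj/enum_rank_inj.
have [B tB [c cP]] := CP (fun S => code (chi (f @` S : set T))).
have [h h_aut hB] := ultrahomogeneous_copy Fhom t_fin
  ((copies_imageP _ _ f_emb).2 tB).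
have h_t (x : T) : x \in map (h : T -> T) t -> exists2 y, B y & f y = x.
  move=> xt; suff : (f @` B) x by [].
  by rewrite -hB (image_set_seq (T := T)).
exists h; split=> // [x /h_t[y _ <-]|].
  by apply/mapP; exists (e' y); rewrite ?mem_enum ?eK.
apply: (monochromatic_inj code_inj); exists c => g g_aut gs.
pose S := f @^-1` [set` map g s].
have fS : f @` S = [set` map g s].
  apply/seteqP; split=> [_ [y Sy <-]//|x xs].
  by have [y _ yx] := h_t _ (gs _ xs); exists y; rewrite // /S /preimage /= yx.
rewrite -(cP S) ?fS //.
  by apply/(copies_imageP _ _ f_emb); rewrite fS -image_set_seq;
    exact: isomorphic_induced_image g_aut.1.
by move=> y /gs/h_t[z Bz /f_inj <-].
Qed.

End AutomorphismGroup.

Theorem mainTheorem3 (L : language) (K : structure L -> Prop) (F : structure L)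
    (R : realType) (M : ptopologicalType) (act : (F -> F) -> M -> M) :
  fraisse_class K -> ramsey_class K -> fraisse_limit K F ->
  universal_minimal_flow act ->
  (* G_K amenable: some invariant Borel probability measure on M(G_K) *)
  (exists mu : probability (borel M) R, invariant_measure act mu) ->
  exists mu : probability (borel M) R,
    [/\ invariant_measure act mu,
        (* unique ergodicity *)
        (forall nu : probability (borel M) R, invariant_measure act nu ->
           forall A : set (borel M), measurable A -> nu A = mu A)
      & exists x : M,
          [/\ dense (g_orbit act x), G_delta (g_orbit act x),
              mu (g_orbit act x) = 1%E
            & forall y : M, dense (g_orbit act y) -> G_delta (g_orbit act y) ->
                g_orbit act y = g_orbit act x]].
Proof.
move=> [Kfin _ _ _ _] Kramsey [[pk pk_inj] [Fage Fhom]] [Mmin Muniv].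
move=> [mu mu_inv].
have [unpk pkK] := inj_pcancel pk_inj.
pose G : permgroup (pcan_type pkK) := aut_group F.
have ramseyG : ramsey_group G by exact: aut_group_ramsey Kfin Kramsey Fage Fhom.
have {}Mmin : gminimal G act by apply/minimal_flowP.
have [Y [actY [ltY [Ymin OY]]]] := exists_order_flow ramseyG.
have [|f [[f_cont f_act] _]] := Muniv Y actY; first exact/minimal_flowP.
have O := equivariant_order_comp (G := G) f_cont f_act OY.
exists mu; split=> // [nu nu_inv A|].
  exact: (ginvariant_measure_unique O Mmin ramseyG nu_inv mu_inv).
by have [x ?] := ginvariant_measure_concentrated Mmin O ramseyG
  (@aut_group_closed L F pk unpk pkK) mu_inv; exists x.
Qed.
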